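(* There are positive absolute constants $C_{\mathrm{diag}}, c$ such that, in the single-sample subgaussian Kronecker-sum model described in the context, the following holds. Let $\Delta_\Omega\in\mathcal K_{\mathbf p}$ (with $\mathrm{diag}(\Delta_\Omega)\neq 0$). Then, with probability at least $1-\sum_{k=1}^L 2\exp(-c\,d_k)$, $$\frac{\big|\langle \mathrm{diag}(\Delta_\Omega),\,\hat S-\Sigma_0\rangle\big|}{\|\Sigma_0\|_2\,\|\mathrm{diag}(\Delta_\Omega)\|_F}\le C_{\mathrm{diag}}\sqrt{d_{\max}L}\,\Big(1+\sqrt{\frac{d_{\max}}{m_{\min}}}\Big).$$
   Context: Dimensions: $L\ge 2$ and $d_1,\dots,d_L$ are positive integers, $p=\prod_{k=1}^L d_k$, $m_k=p/d_k$, $m_{\min}=\min_k m_k$, $d_{\max}=\max_k d_k$. Norms: $\|A\|_2$ is the operator norm, $\|A\|_F$ the Frobenius norm, $\langle A,B\rangle=\mathrm{tr}(A^TB)$; $\mathrm{diag}(A)$ is the diagonal part of a square matrix $A$ (as a diagonal matrix). Kronecker sums: for $B_k\in\mathbb{R}^{d_k\times d_k}$, $B_1\oplus\cdots\oplus B_L:=\sum_{k=1}^L I_{d_1}\otimes\cdots\otimes I_{d_{k-1}}\otimes B_k\otimes I_{d_{k+1}}\otimes\cdots\otimes I_{d_L}$. Let $\mathcal K_{\mathbf p}\subset\mathbb{R}^{p\times p}$ be the set of all such Kronecker sums. Model: $\Omega_0=\Psi_1\oplus\cdots\oplus\Psi_L\succ 0$ with symmetric $\Psi_k\in\mathbb R^{d_k\times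 d_k}$, and $\Sigma_0=\Omega_0^{-1}$. For a tensor $X\in\mathbb{R}^{d_1\times\cdots\times d_L}$, $\mathrm{vec}(X^T)\in\mathbb{R}^p$ lists the entries $X_{i_1,\dots,i_L}$ in lexicographic order ($i_1$ slowest, $i_L$ fastest). The random tensor $X$ satisfies $\mathrm{vec}(X^T)=\Sigma_0^{1/2}Z$, where $Z\in\mathbb{R}^p$ has independent components with $\mathbb{E}Z_j=0$, $\mathbb{E}Z_j^2=1$, $\|Z_j\|_{\psi_2}\le C_0$ for all $j$; here $\|Y\|_{\psi_2}=\inf\{t>0:\mathbb{E}\exp(Y^2/t^2)\le 2\}$. There is one sample ($n=1$) and $\hat S=\mathrm{vec}(X^T)\,\mathrm{vec}(X^T)^T$. Absolute constants may depend on $C_0$ but not on the dimensions, $L$ or $\Omega_0$. *)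

(* Defs.v *)
From HB Require Import structures.
From mathcomp Require Import all_boot all_order all_algebra.
From mathcomp Require Import all_classical all_reals all_analysis.
From mathcomp Require Export mxtens.

Set Implicit Arguments.
Unset Strict Implicit.
Unset Printing Implicit Defensive.
Import Order.TTheory GRing.Theory Num.Theory.
Import numFieldNormedType.Exports.
Local Open Scope classical_set_scope.
Local Open Scope ring_scope.

(** Dimension families: [d k] with k : 'I_L stands for d_(k+1). *)

(* p, by recursion so that iterated tensor products need no cast;
   [kdimE] gives the usual product. *)
Fixpoint kdim {L : nat} : ('I_L -> nat) -> nat :=
  match L with
  | 0 => fun _ => 1%N
  | L'.+1 => fun d => (d ord0 * kdim (fun k : 'I_L' => d (lift ord0 k)))%N
  end.

Lemma kdimE (L : nat) (d : 'I_L -> nat) : kdim d = (\prod_(k < L) d k)%N.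
Proof.
elim: L d => [|L IH] d /=; first by rewrite big_ord0.
by rewrite big_ord_recl IH.
Qed.

Definition codim (L : nat) (d : 'I_L -> nat) (k : 'I_L) : nat :=
  (kdim d %/ d k)%N.

Definition dmax (L : nat) (d : 'I_L -> nat) : nat := \max_(k < L) d k.

(* The unit [kdim d] of the minimum is harmless: it bounds every [codim d k]. *)
Definition mmin (L : nat) (d : 'I_L -> nat) : nat :=
  \big[minn/kdim d]_(k < L) codim d k.

(** Matrices *)
Section Matrices.
Variable R : realType.

Definition mxinner (m n : nat) (A B : 'M[R]_(m, n)) : R := \tr (A^T *m B).

(* On column vectors this is the Euclidean norm. *)
Definition fnorm (m n : nat) (A : 'M[R]_(m, n)) : R := Num.sqrt (mxinner A A).

Definition opnorm (m n : nat) (A : 'M[R]_(m, n)) : R :=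
  sup [set fnorm (A *m x) | x in [set x : 'cV[R]_n | fnorm x <= 1]].

Definition diag_part (n : nat) (A : 'M[R]_n) : 'M[R]_n :=
  diag_mx (\row_i A i i).

Definition symmx (n : nat) (A : 'M[R]_n) : Prop := A^T = A.

Definition posdef (n : nat) (A : 'M[R]_n) : Prop :=
  symmx A /\ forall x : 'cV[R]_n, x != 0 -> 0 < (x^T *m A *m x) 0 0.

Definition possemidef (n : nat) (A : 'M[R]_n) : Prop :=
  symmx A /\ forall x : 'cV[R]_n, 0 <= (x^T *m A *m x) 0 0.

(* S = A^(1/2): the symmetric positive semidefinite square root, which is
   unique when it exists. *)
Definition is_sqrtmx (n : nat) (A S : 'M[R]_n) : Prop :=
  possemidef S /\ S *m S = A.

(* A_1 (x) ... (x) A_L. The indices of [tensmx] (from mxtens) are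
   lexicographic: the pair (i, j) is sent to i * n + j. *)
Fixpoint kprod {L : nat} :
    forall d : 'I_L -> nat, (forall k, 'M[R]_(d k)) -> 'M[R]_(kdim d) :=
  match L with
  | 0 => fun _ _ => 1%:M
  | L'.+1 => fun d A => tensmx (A ord0) (kprod (fun k => A (lift ord0 k)))
  end.

Definition ksum (L : nat) (d : 'I_L -> nat) (B : forall k, 'M[R]_(d k)) :
    'M[R]_(kdim d) :=
  \sum_(k < L) kprod (fun l => if l == k then B l else 1%:M).

Definition Kset (L : nat) (d : 'I_L -> nat) : set 'M[R]_(kdim d) :=
  range (fun B : (forall k, 'M[R]_(d k)) => ksum B).

(* R^(d_1 x ... x d_L), in curried form: X i_1 ... i_L is an entry. *)
Fixpoint tensor {L : nat} : ('I_L -> nat) -> Type :=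
  match L with
  | 0 => fun _ => R
  | L'.+1 => fun d => 'I_(d ord0) -> tensor (fun k : 'I_L' => d (lift ord0 k))
  end.

(* vec(X^T): entries in lexicographic order, i_1 slowest and i_L fastest. *)
Fixpoint vecT {L : nat} :
    forall d : 'I_L -> nat, tensor d -> 'cV[R]_(kdim d) :=
  match L with
  | 0 => fun _ X => const_mx X
  | L'.+1 => fun d X =>
      \col_i vecT (X (mxtens_unindex i).1) (mxtens_unindex i).2 0
  end.

End Matrices.

Arguments Kset R {L} d.

(** Probability *)
Section Probability.
Context {disp : measure_display} {T : measurableType disp} {R : realType}.
Variable P : probability T R.

Definition mutually_independent (n : nat) (Z : 'I_n -> {RV P >-> R}) : Prop :=
  forall (J : {set 'I_n}) (B : 'I_n -> set R),
    (forall j, measurable (B j)) ->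
    P [set w | forall j, j \in J -> B j (Z j w)]
    = (\prod_(j in J) P (Z j @^-1` B j))%E.

(* Extended-real valued, so that the norm is +oo (rather than the junk value
   of a real infimum) when no t is admissible. *)
Definition psi2norm (Y : T -> R) : \bar R :=
  ereal_inf [set t%:E | t in [set t : R | 0 < t /\
    ('E_P[(fun w => expR (Y w ^+ 2 / t ^+ 2))%R] <= 2%:E)%E]].

End Probability.

(* Main.v *)
Require Import Defs.
From HB Require Import structures.
From mathcomp Require Import all_boot all_order all_algebra.
From mathcomp Require Import all_classical all_reals all_analysis.
From mathcomp Require Import measurable_realfun.
From mathcomp Require Import ring lra.

(** The matrix Delta is fixed, so the quantity to bound is a single centered
    quadratic form.  With S the square root of Sigma, D = diag Delta and
    A = S D S, one has <D, x x^T - Sigma> = Z^T A Z - tr A for x = S Z, and the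
    claim is a Hanson-Wright inequality combined with two norm bounds.

    Norm bounds.  Let r = |Sigma|_2 |D|_F.  Since |S y|^2 <= |Sigma|_2 |y|^2, the
    Frobenius norm of A is at most r ([sqfrob_conj]) and its operator norm is at
    most |Sigma|_2 max_i |D_ii|.  The diagonal of a Kronecker sum is an additive
    function of the multi-index, which cannot concentrate at a point:
    max_i |D_ii| <= 2 sqrt (L / m_min) |D|_F ([Kset_diag_norm_le]).  At the level
    t = C r sqrt (d_max L) (1 + sqrt (d_max / m_min)) both terms of the
    Hanson-Wright exponent are then at least of order d_max
    ([chernoff_parameter]), and exp (- d_max) is one of the summands of the
    allowed failure probability.

    Hanson-Wright ([hanson_wright]).  The form splits into its diagonal part, a
    sum of independent centered variables A_ii (Z_i^2 - 1) treated by a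
    Bernstein bound ([mgf_diagonal]), and its off-diagonal part.  For the latter
    no decoupling is needed: the coordinates are integrated out one after the
    other.  If a >= 0 is the current coefficient of Z_i^2 and 2 s that of Z_i
    (after scaling), then E exp (a Z_i^2 + 2 s Z_i) is at most
    exp (a + s^2 / (1 - a)) ([mgf_quadratic]), which replaces the matrix N of
    the form by the Schur complement of Gaussian elimination in 1 - N, at the
    price of exp a ([mgf_qform]).  The sum of these a is at most
    tr ((1 - N)^-1 - 1) ([pivots_le_trace]), which for a symmetric N <= 1/2 with
    zero diagonal is at most 2 |N|_F^2 ([pivots_le]). *)

Set Implicit Arguments.
Unset Strict Implicit.
Unset Printing Implicit Defensive.
Import Order.TTheory GRing.Theory Num.Theory.
Import numFieldNormedType.Exports.
Local Open Scope classical_set_scope.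
Local Open Scope ring_scope.

(** * Quadratic forms and Gaussian elimination *)

Section QuadraticForms.
Variable R : realFieldType.

Definition dotv n (x y : 'cV[R]_n) : R := (x^T *m y) 0 0.

Lemma dotvE n (x y : 'cV[R]_n) : dotv x y = \sum_i x i 0 * y i 0.
Proof. by rewrite /dotv mxE; apply: eq_bigr => i _; rewrite mxE. Qed.

Lemma dotvC n (x y : 'cV[R]_n) : dotv x y = dotv y x.
Proof. by rewrite !dotvE; apply: eq_bigr => i _; rewrite mulrC. Qed.

Lemma dotvDr n (x y z : 'cV[R]_n) : dotv x (y + z) = dotv x y + dotv x z.
Proof. by rewrite /dotv mulmxDr mxE. Qed.

Lemma dotvZr n (x : 'cV[R]_n) k y : dotv x (k *: y) = k * dotv x y.
Proof. by rewrite /dotv -scalemxAr mxE. Qed.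

Lemma dotvBr n (x y z : 'cV[R]_n) : dotv x (y - z) = dotv x y - dotv x z.
Proof. by rewrite -scaleN1r dotvDr dotvZr mulN1r. Qed.

Lemma dotv_ge0 n (x : 'cV[R]_n) : 0 <= dotv x x.
Proof. by rewrite dotvE; apply: sumr_ge0 => i _; rewrite -expr2 sqr_ge0. Qed.

Lemma dotv_eq0 n (x : 'cV[R]_n) : dotv x x = 0 -> x = 0.
Proof.
rewrite dotvE => /eqP; rewrite psumr_eq0; last first.
  by move=> i _; rewrite -expr2 sqr_ge0.
move=> /allP x0; apply/colP => i; rewrite mxE; apply/eqP.
by have := x0 i (mem_index_enum _); rewrite mulf_eq0 orbb.
Qed.

Lemma dotv_mulmxr n m (A : 'M[R]_(n, m)) x y :
  dotv x (A *m y) = dotv (A^T *m x) y.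
Proof. by rewrite /dotv trmx_mul trmxK mulmxA. Qed.

Lemma dotv_col_mx n (z t : R) (x y : 'cV[R]_n) :
  dotv (col_mx z%:M x) (col_mx t%:M y) = z * t + dotv x y.
Proof.
by rewrite /dotv tr_col_mx mul_row_col mxE tr_scalar_mx -scalar_mxM mxE eqxx.
Qed.

Definition qform n (N : 'M[R]_n) (x : 'cV[R]_n) : R := dotv x (N *m x).

Lemma qform_block n (a : R) (u : 'cV[R]_n) (N : 'M[R]_n) z y :
  qform (block_mx a%:M u^T u N) (col_mx z%:M y)
  = a * z ^+ 2 + 2 * z * dotv u y + qform N y.
Proof.
rewrite /qform mul_block_col.
have -> : a%:M *m z%:M + u^T *m y = (a * z + dotv u y)%:M :> 'M[R]_1.
  by rewrite [u^T *m y]mx11_scalar -scalar_mxM -raddfD.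
rewrite dotv_col_mx dotvDr mul_mx_scalar dotvZr (dotvC y u).
by ring.
Qed.

Lemma qformD n (A B : 'M[R]_n) x : qform (A + B) x = qform A x + qform B x.
Proof. by rewrite /qform mulmxDl dotvDr. Qed.

Lemma qformZ n k (A : 'M[R]_n) x : qform (k *: A) x = k * qform A x.
Proof. by rewrite /qform -scalemxAl dotvZr. Qed.

Lemma qform_rank1 n (u x : 'cV[R]_n) : qform (u *m u^T) x = dotv u x ^+ 2.
Proof.
rewrite /qform -mulmxA [u^T *m x]mx11_scalar mul_mx_scalar dotvZr.
by rewrite (dotvC x u) expr2.
Qed.

(** With u the part of the first column of N below the diagonal and N' the
    lower right block, 1 - schur N is the Schur complement of 1 - N 0 0 in
    1 - N.  It arises because integrating exp (a z^2 + 2 z <u, y>) against a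
    Gaussian weight exp (- z^2) leaves exp (<u, y>^2 / (1 - a)), up to a factor
    that does not depend on y. *)
Definition schur n (N : 'M[R]_(1 + n)) : 'M[R]_n :=
  drsubmx N + (1 - N 0 0)^-1 *: (dlsubmx N *m (dlsubmx N)^T).

(** If p_1, ..., p_n are the pivots of 1 - N in Gaussian elimination, this is
    the sum of the 1 - p_i. *)
Fixpoint pivots n : 'M[R]_n -> R :=
  if n is n'.+1 then
    fun N : 'M[R]_(1 + n') => N 0 0 + pivots (schur N)
  else fun _ => 0.

Lemma sym_blockE n (N : 'M[R]_(1 + n)) : N^T = N ->
  N = block_mx (N 0 0)%:M (dlsubmx N)^T (dlsubmx N) (drsubmx N).
Proof.
move=> symN; rewrite -[LHS]submxK; congr block_mx.
  by rewrite [LHS]mx11_scalar !mxE lshift0.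
by rewrite trmx_dlsub symN.
Qed.

Lemma schur_sym n (N : 'M[R]_(1 + n)) : N^T = N -> (schur N)^T = schur N.
Proof.
move=> symN; rewrite /schur linearD/= linearZ/= trmx_mul trmxK.
by rewrite trmx_drsub symN.
Qed.

Lemma qform_schur n (N : 'M[R]_(1 + n)) y :
  qform (schur N) y
  = qform (drsubmx N) y + (1 - N 0 0)^-1 * dotv (dlsubmx N) y ^+ 2.
Proof. by rewrite /schur qformD qformZ qform_rank1. Qed.

Definition halfbounded n (N : 'M[R]_n) :=
  forall x, qform N x <= 2^-1 * dotv x x.

Lemma halfbounded_head n (N : 'M[R]_(1 + n)) :
  N^T = N -> halfbounded N -> N 0 0 <= 2^-1.
Proof.
move=> symN /(_ (col_mx 1%:M 0)).
rewrite (sym_blockE symN) qform_block dotv_col_mx.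
have z0 k (x : 'cV[R]_k) : dotv x 0 = 0 by rewrite /dotv mulmx0 mxE.
rewrite /qform mulmx0 !z0 -(sym_blockE symN); lra.
Qed.

(** The quadratic form of 1 - schur N at y is the minimum over z of the form of
    1 - N at (z, y), so a lower bound on 1 - N survives the elimination of a
    coordinate; the minimum is attained at z = <u, y> / (1 - a). *)
Lemma halfbounded_schur n (N : 'M[R]_(1 + n)) :
  N^T = N -> halfbounded N -> halfbounded (schur N).
Proof.
move=> symN bN y.
have a12 := halfbounded_head symN bN.
rewrite qform_schur; set a := N 0 0 in a12 *; set s := dotv _ y.
have := bN (col_mx (s / (1 - a))%:M y).
rewrite {1}(sym_blockE symN) qform_block dotv_col_mx -/a -/s.
have b0 : 0 < 1 - a by lra.
have b1 : 1 - a != 0 by rewrite gt_eqF.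
set Q := qform _ _; set D := dotv y y => h.
pose t := s / (1 - a).
have -> : (1 - a)^-1 * s ^+ 2 = (1 - a) * t ^+ 2 by rewrite /t; field.
have sE : s = (1 - a) * t by rewrite /t; field.
move: h; rewrite -/t sE.
have t2 : 0 <= t ^+ 2 by rewrite sqr_ge0.
lra.
Qed.

Lemma diag_schur_ge0 n (N : 'M[R]_(1 + n)) : N 0 0 <= 2^-1 ->
  (forall i, 0 <= N i i) -> forall i, 0 <= schur N i i.
Proof.
move=> a12 dN i; rewrite /schur !mxE big_ord1 !mxE addr_ge0//.
rewrite mulr_ge0 ?invr_ge0//; first lra.
by rewrite -expr2 sqr_ge0.
Qed.

(** The inverse of the Schur complement is the lower right block W' of the
    inverse W of 1 - N, so it suffices that the upper left entry of W exceeds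
    1 by at least the first pivot defect a.  That entry is at least 1 / (1 - a)
    because W' is nonnegative. *)
Lemma pivots_le_trace n (N W : 'M[R]_n) :
  N^T = N -> halfbounded N -> (1%:M - N) *m W = 1%:M ->
  pivots N <= \tr W - n%:R.
Proof.
elim: n N W => [|n IH] N W symN bN NW.
  by rewrite /= /mxtrace big_ord0 subr0.
rewrite [pivots N]/=.
have a12 := halfbounded_head symN bN.
have bS := halfbounded_schur symN bN.
have sS := schur_sym symN.
pose a := N 0 0; pose u : 'cV[R]_n := dlsubmx (N : 'M[R]_(1 + n)).
pose N' : 'M[R]_n := drsubmx (N : 'M[R]_(1 + n)).
pose W0 : 'M[R]_(1 + n) := W.
pose w := ulsubmx W0; pose r := ursubmx W0; pose c := dlsubmx W0.
pose W' := drsubmx W0.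
have : (1%:M - block_mx a%:M u^T u N') *m block_mx w r c W'
     = 1%:M :> 'M[R]_(1 + n).
  by rewrite /a /u /N' -sym_blockE// submxK.
rewrite (@scalar_mx_block _ 1 n) opp_block_mx add_block_mx mulmx_block.
move=> /eq_block_mx[]; rewrite !add0r.
have -> : 1%:M - a%:M = (1 - a)%:M :> 'M[R]_1 by rewrite raddfB.
rewrite !mul_scalar_mx !mulNmx => E1 E2 E3 E4.
have b0 : 0 < 1 - a by rewrite /a; lra.
have b1 : 1 - a != 0 by rewrite gt_eqF.
have rE : r = (1 - a)^-1 *: (u^T *m W').
  move/eqP: E2; rewrite subr_eq0 => /eqP <-.
  by rewrite scalerA mulVf// scale1r.
have SW : (1%:M - schur N) *m W' = 1%:M.
  rewrite -[RHS]E4 rE /schur -/a -/u -/N' opprD addrA mulmxBl.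
  by rewrite -scalemxAl -scalemxAr mulmxA [RHS]addrC.
(* c = (1 - a)^-1 W' u and w (1 - a) = 1 + <u, c>, whence w >= 1 / (1 - a) *)
have WS : W' *m (1%:M - schur N) = 1%:M by exact: mulmx1C.
have kE : dotv u c = (1 - a) * w 0 0 - 1.
  move/(congr1 (fun A : 'M[R]_1 => A 0 0)): E1.
  rewrite mxE [X in X + _]mxE [X in _ + X]mxE -/(dotv u c) [RHS]mxE eqxx/=.
  rewrite mulr1n; lra.
pose x := W' *m u.
have Sc : (1%:M - schur N) *m c = (1 - a)^-1 *: u.
  rewrite /schur -/a -/u -/N' opprD addrA mulmxBl -scalemxAl -mulmxA.
  rewrite [u^T *m c]mx11_scalar -/(dotv u c) kE mul_mx_scalar.
  move/eqP: E3; rewrite addr_eq0 eqr_opp => /eqP <-.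
  rewrite [w]mx11_scalar mul_mx_scalar scalerA -scalerBl; congr (_ *: _).
  by rewrite !mxE eqxx mulr1n; field.
have cE : c = (1 - a)^-1 *: x.
  by rewrite /x -[LHS]mul1mx -WS -mulmxA Sc -scalemxAr.
have ux : 0 <= dotv u x.
  have -> : u = (1%:M - schur N) *m x by rewrite /x mulmxA SW mul1mx.
  rewrite dotvC mulmxBl mul1mx dotvBr -/(qform _ x).
  have := bS x; have := dotv_ge0 x; lra.
have w1 : a <= w 0 0 - 1.
  have : 0 <= (1 - a) * (dotv u c).
    by rewrite cE dotvZr mulrA mulfV// mul1r.
  rewrite kE pmulr_rge0// => h.
  have : 0 <= (1 - a) * (w 0 0 - 1 - a) by have := sqr_ge0 a; lra.
  by rewrite pmulr_rge0//; lra.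
have := IH _ W' sS bS SW.
have -> : \tr W = w 0 0 + \tr W'.
  rewrite (_ : \tr W = \tr (block_mx w r c W')); last by rewrite submxK.
  by rewrite (@mxtrace_block _ 1 n) {1}/mxtrace big_ord1.
rewrite -/a -[n.+1%:R]natr1; lra.
Qed.

Definition sqfrob m n (M : 'M[R]_(m, n)) : R := \sum_i \sum_j M i j ^+ 2.

(** The inverse W of 1 - N equals 1 + N + N W N and is at most 2 as a quadratic
    form.  For a matrix with zero diagonal the trace term vanishes: this is why
    the logarithm of the moment generating function of an off-diagonal form is
    of the order of the squared Frobenius norm, although every integration step
    only yields a bound linear in a pivot. *)
Lemma pivots_le n (N : 'M[R]_n) : N^T = N -> halfbounded N ->
  pivots N <= \tr N + 2 * sqfrob N.
Proof.
move=> symN bN.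
have unitN : 1%:M - N \in unitmx.
  rewrite -row_free_unit -kermx_eq0; apply/rowV0P => v /sub_kermxP vN.
  have : dotv v^T ((1%:M - N) *m v^T) = 0.
    by rewrite dotv_mulmxr linearB/= trmx1 symN /dotv trmx_mul trmxK linearB/= symN
      trmx1 vN mul0mx mxE.
  rewrite mulmxBl mul1mx dotvBr -/(qform _ _).
  have := bN v^T; have := dotv_ge0 v^T => h1 h2 h3.
  have /dotv_eq0 : dotv v^T v^T = 0 by lra.
  by move=> /(congr1 trmx); rewrite trmxK trmx0.
pose W := invmx (1%:M - N).
have NW : (1%:M - N) *m W = 1%:M by rewrite mulmxV.
have WN : W *m (1%:M - N) = 1%:M by rewrite mulVmx.
apply: le_trans (pivots_le_trace symN bN NW) _.
have WE : W = 1%:M + N + N *m W *m N.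
  have h1 : W = 1%:M + N *m W by rewrite -[X in X + _]NW mulmxBl mul1mx subrK.
  have h2 : W = 1%:M + W *m N by rewrite -[X in X + _]WN mulmxBr mulmx1 subrK.
  by rewrite {1}h1 {1}h2 mulmxDr mulmx1 mulmxA addrA.
have Wle x : dotv x (W *m x) <= 2 * dotv x x.
  have xE : x = (1%:M - N) *m (W *m x) by rewrite mulmxA NW mul1mx.
  set y := W *m x.
  have : 2^-1 * dotv y y <= dotv x y.
    rewrite {1}xE -/y dotvC mulmxBl mul1mx dotvBr -/(qform _ _).
    by have := bN y; lra.
  have : 0 <= dotv (y - 2 *: x) (y - 2 *: x) by exact: dotv_ge0.
  rewrite dotvBr dotvZr !(dotvC (y - 2 *: x)) !dotvBr !dotvZr (dotvC y x).
  lra.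
have trW : \tr W = n%:R + \tr N + \tr (N *m W *m N).
  by rewrite {1}WE !mxtraceD mxtrace1.
suff : \tr (N *m W *m N) <= 2 * sqfrob N by rewrite trW; lra.
rewrite /sqfrob mulr_sumr /mxtrace; apply: ler_sum => i _.
have -> : (N *m W *m N) i i = dotv (col i N) (W *m col i N).
  rewrite /dotv mulmxA tr_col symN -row_mul [LHS]mxE [RHS]mxE.
  by apply: eq_bigr => j _; rewrite [row _ _ _ _]mxE [col _ _ _ _]mxE.
apply: le_trans (Wle _) _.
rewrite dotvE ler_pM2l//; apply: ler_sum => j _.
by rewrite !mxE -expr2 -{1}symN mxE.
Qed.

End QuadraticForms.

(** * Integration of independent variables one at a time *)

Section Independence.
Context {disp : measure_display} {T : measurableType disp} {R : realType}.
Variable P : probability T R.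

Lemma independent_tail n (Z : 'I_n.+1 -> {RV P >-> R}) :
  mutually_independent Z -> mutually_independent (fun i => Z (lift ord0 i)).
Proof.
move=> indZ J B mB.
pose B' (i : 'I_n.+1) := if unlift ord0 i is Some j then B j else setT.
have mB' i : measurable (B' i).
  by rewrite /B'; case: unliftP => // j _; exact: mB.
have := indZ [set lift ord0 j | j in J]%SET B' mB'.
rewrite big_imset/=; last by move=> i j _ _; exact: lift_inj.
rewrite (eq_bigr (fun j => P (Z (lift ord0 j) @^-1` B j))); last first.
  by move=> j _; rewrite /B' liftK.
move=> <-; congr (P _); apply/seteqP; split=> w /= h.
  by move=> _ /imsetP[j jJ ->]; rewrite /B' liftK; exact: h.
by move=> j jJ; have := h _ (imset_f _ jJ); rewrite /B' liftK.
Qed.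

Section Tuple.
Variables (n : nat) (Z : 'I_n -> {RV P >-> R}).

Definition tuple_rv (w : T) : n.-tuple R := [tuple Z i w | i < n].

Lemma measurable_tuple_rv : measurable_fun setT tuple_rv.
Proof.
apply/measurable_fun_tnthP => i.
rewrite (_ : _ \o _ = Z i)//.
by apply/funext => w /=; rewrite tnth_mktuple.
Qed.

HB.instance Definition _ :=
  isMeasurableFun.Build _ _ _ _ tuple_rv measurable_tuple_rv.

End Tuple.

(** The rectangles form a pi-system on which independence is given, and they
    generate the sigma-algebra of the tuples. *)
Definition boxes n : set (set (n.-tuple R)) :=
  [set B | exists b : 'I_n -> set R, (forall i, measurable (b i)) /\
     B = [set y | forall i, b i (tnth y i)]].

Lemma measurable_boxE n : @measurable _ (n.-tuple R) = <<s @boxes n >>.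
Proof.
apply/seteqP; split.
  apply: smallest_sub; first exact: smallest_sigma_algebra.
  rewrite -bigcup_seq/=; apply: bigcup_sub => i _ _ [A mA <-].
  apply: sub_sigma_algebra; exists (fun j => if j == i then A else setT).
  split=> [j|]; first by case: ifP.
  rewrite setTI; apply/seteqP; split=> y /=.
    by move=> Ay j; case: eqP => // ->.
  by move=> /(_ i); rewrite eqxx.
apply: smallest_sub; first exact: sigma_algebra_measurable.
move=> _ [b [mb ->]].
rewrite (_ : mkset _ = \bigcap_(i in [set: 'I_n]) ((@tnth n R ^~ i) @^-1` b i)).
  apply: fin_bigcap_measurable; first exact: finite_finset.
  move=> i _; rewrite -[X in measurable X]setTI.
  exact: (measurable_tnth i).
by apply/seteqP; split=> y /= h i; [move=> _|]; exact: h.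
Qed.

Lemma setI_closed_boxes n : setI_closed (@boxes n).
Proof.
move=> _ _ [b [mb ->]] [c [mc ->]].
exists (fun i => b i `&` c i); split; first by move=> i; exact: measurableI.
apply/seteqP; split=> y /=; first by move=> [h k] i; split; [exact: h|exact: k].
by move=> h; split=> i; have [] := h i.
Qed.

(** For fixed A, both sides are finite measures in B that agree on boxes. *)
Lemma independent_head_tailP n (Z : 'I_n.+1 -> {RV P >-> R}) :
  mutually_independent Z ->
  forall (A : set R) (B : set (n.-tuple R)), measurable A -> measurable B ->
  (P ((Z ord0 @^-1` A) `&` (tuple_rv (fun i => Z (lift ord0 i)) @^-1` B)) =
   P (Z ord0 @^-1` A) * P (tuple_rv (fun i => Z (lift ord0 i)) @^-1` B))%E.
Proof.
move=> indZ A B mA mB.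
pose Y : {mfun T >-> n.-tuple R} := tuple_rv (fun i : 'I_n => Z (lift ord0 i)).
rewrite -/(Y : T -> n.-tuple R).
have mZA : measurable (Z ord0 @^-1` A) by exact: measurable_funPTI.
have mY C : measurable C -> measurable (Y @^-1` C).
  by move=> mC; exact: measurable_funPTI.
pose m1 := pushforward (mrestr P mZA) Y.
have c0 : 0 <= fine (P (Z ord0 @^-1` A)) by rewrite fine_ge0.
pose m2 : set (n.-tuple R) -> \bar R := mscale (NngNum c0) (distribution P Y).
have PA : (P (Z ord0 @^-1` A) = (fine (P (Z ord0 @^-1` A)))%:E)%E.
  by rewrite fineK// fin_num_measure.
have -> : (P ((Z ord0 @^-1` A) `&` (Y @^-1` B)) = m1 B)%E.
  by rewrite /m1 /pushforward /mrestr setIC.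
rewrite [RHS](_ : _ = m2 B)%E; last first.
  by rewrite [in LHS]PA.
have mYf : measurable_fun setT Y by [].
apply: (@measure_unique _ R _ (@boxes n) (fun _ => setT) _ _ _ _
  (pushforward (mrestr P mZA) Y)
  (mscale (NngNum c0) (distribution P Y))) => //=.
- exact: measurable_boxE.
- exact: setI_closed_boxes.
- move=> _; exists (fun _ => setT); split=> //.
  by apply/seteqP; split.
- by rewrite bigcup_const.
- move=> _ [b [mb ->]].
  rewrite /mscale/= -PA /distribution /pushforward /mrestr.
  pose b' i := if unlift ord0 i is Some j then b j else A.
  have mb' i : measurable (b' i) by rewrite /b'; case: unliftP.
  have b'0 : b' ord0 = A by rewrite /b' unlift_none.
  have b'S j : b' (lift ord0 j) = b j by rewrite /b' liftK.
  have := indZ [set: 'I_n.+1]%SET b' mb'.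
  have := independent_tail indZ [set: 'I_n]%SET mb.
  under eq_bigl do rewrite inE.
  move=> h1.
  under eq_bigl do rewrite inE.
  rewrite big_ord_recl b'0.
  under eq_bigr do rewrite b'S.
  rewrite -h1 => h2.
  transitivity (P [set w | forall j, j \in [set: 'I_n.+1]%SET -> b' j (Z j w)]).
    congr (P _); apply/seteqP; split=> w /=.
      move=> [h hA] j _; rewrite /b'; case: unliftP => [i ->|->//].
      by have := h i; rewrite /Y tnth_mktuple.
    move=> h; split=> [i|].
      by have := h (lift ord0 i) (finset.in_setT _); rewrite b'S /Y tnth_mktuple.
    by have := h ord0 (finset.in_setT _); rewrite /b' unlift_none.
  rewrite h2; congr (_ * P _)%E; apply/seteqP; split=> w /=.
    by move=> h i; rewrite /Y tnth_mktuple; apply: h; rewrite inE.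
  by move=> h i _; have := h i; rewrite /Y tnth_mktuple.
- move=> _; rewrite /pushforward /mrestr.
  rewrite (le_lt_trans (probability_le1 _ _))//; last exact: ltry.
  by apply: measurableI => //; exact: mY.
Qed.

(** Tonelli's theorem for the first variable against the tuple of the others.
    The inequality, rather than the equality with an iterated integral, is what
    an induction on the number of variables consumes: f is the integrand for
    the remaining variables. *)
Lemma independent_integral_le n (Z : 'I_n.+1 -> {RV P >-> R})
    (h : R * n.-tuple R -> \bar R) (f : n.-tuple R -> \bar R) :
  mutually_independent Z ->
  measurable_fun [set: R * n.-tuple R] h -> (forall zy, 0 <= h zy)%E ->
  measurable_fun [set: n.-tuple R] f ->
  (forall y, \int[P]_w h (Z ord0 w, y) <= f y)%E ->
  (\int[P]_w h (Z ord0 w, tuple_rv (fun i => Z (lift ord0 i)) w) <=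
   \int[P]_w f (tuple_rv (fun i => Z (lift ord0 i)) w))%E.
Proof.
move=> indZ mh h0 mf hf.
pose Y : {mfun T >-> n.-tuple R} := tuple_rv (fun i : 'I_n => Z (lift ord0 i)).
rewrite -/(Y : T -> n.-tuple R).
have f0 y : (0 <= f y)%E by apply: le_trans (hf y); exact: integral_ge0.
pose X w := (Z ord0 w, Y w).
have mX : measurable_fun setT X by exact: measurable_fun_pair.
pose m1 := distribution P (Z ord0); pose m2 := distribution P Y.
have -> : (\int[P]_w h (Z ord0 w, Y w) = \int[m1 \x m2]_z h z)%E.
  rewrite (_ : \int[m1 \x m2]_z h z = \int[pushforward P X]_z h z)%E; last first.
    apply: eq_measure_integral => A mA _.
    pose XX : {mfun T >-> (R * n.-tuple R)%type} :=
      HB.pack X (isMeasurableFun.Build _ _ _ _ X mX).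
    have prodE : (m1 \x m2)%E A = distribution P XX A.
      apply: product_measure_unique => // B C mB mC.
      rewrite /m1 /m2 /distribution /pushforward.
      by rewrite -independent_head_tailP.
    exact: prodE.
  by rewrite ge0_integral_pushforward.
have -> : (\int[P]_w f (Y w) = \int[m2]_y f y)%E.
  by rewrite ge0_integral_pushforward//= => y _; exact: f0.
rewrite fubini_tonelli2//; apply: ge0_le_integral => //=.
- by move=> y _; exact: integral_ge0.
- exact: measurable_fun_fubini_tonelli_G.
move=> y _; apply: le_trans (hf y).
rewrite /fubini_G/= ge0_integral_pushforward//=.
exact: measurableT_comp.
Qed.

End Independence.

(** * Exponential moments of one subgaussian variable *)

Section ExpInequalities.
Variable R : realType.
Implicit Types x u v t : R.

Lemma expR_le_inv x : x < 1 -> expR x <= (1 - x)^-1.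
Proof.
move=> x1; have h := expR_ge1Dx (- x).
rewrite -[x in expR x]opprK expRN lef_pV2 ?posrE ?expR_gt0//; lra.
Qed.

Lemma expR_le_quad_small x : x <= 2^-1 -> expR x <= 1 + x + 2 * x ^+ 2.
Proof.
move=> x2; have x1 : 0 < 1 - x by lra.
apply: (le_trans (expR_le_inv _)); first lra.
rewrite -[leLHS]mul1r ler_pdivrMr//.
have : 0 <= x ^+ 2 * (1 - 2 * x) by apply: mulr_ge0; [exact: sqr_ge0|lra].
lra.
Qed.

(** The linear term has mean zero when x is replaced by a centered variable,
    so this turns a bound on E exp (2 s^2 X^2) into one on E exp (s X). *)
Lemma expR_le_sqr x : expR x <= x + expR (2 * x ^+ 2).
Proof.
have [x2|x2] := leP x 2^-1.
  have := expR_ge1Dx (2 * x ^+ 2); have := expR_le_quad_small x2; lra.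
have : expR x <= expR (2 * x ^+ 2).
  rewrite ler_expR; have : 0 <= x * (2 * x - 1) by apply: mulr_ge0; lra.
  lra.
lra.
Qed.

Lemma expR_le_quad u : expR u <= 1 + u + 4 * u ^+ 2 * expR `|u|.
Proof.
have [u2|u2] := leP u 2^-1.
  apply: (le_trans (expR_le_quad_small u2)).
  rewrite lerD2l; have u0 := sqr_ge0 u.
  have : 1 <= expR `|u| by rewrite -expR0 ler_expR.
  have : 0 <= u ^+ 2 * (expR `|u| - 1).
    by rewrite mulr_ge0// subr_ge0 -expR0 ler_expR.
  lra.
rewrite ger0_norm; last lra.
have : 0 <= (4 * u ^+ 2 - 1) * expR u.
  apply: mulr_ge0; last exact: expR_ge0.
  have : 0 <= (u - 2^-1) * (u + 2^-1) by apply: mulr_ge0; lra.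
  lra.
lra.
Qed.

Lemma expR_convex t u v : 0 <= t -> t <= 1 ->
  expR (t * u + (1 - t) * v) <= t * expR u + (1 - t) * expR v.
Proof.
move=> t0 t1; set m := t * u + _.
have h y : expR m * (1 + (y - m)) <= expR y.
  have := expR_ge1Dx (y - m); rewrite expRB ler_pdivlMr ?expR_gt0//.
  by rewrite mulrC.
have h1 : t * (expR m * (1 + (u - m))) <= t * expR u by rewrite ler_wpM2l.
have h2 : (1 - t) * (expR m * (1 + (v - m))) <= (1 - t) * expR v.
  by rewrite ler_wpM2l//; lra.
apply: le_trans (lerD h1 h2); rewrite le_eqVlt; apply/orP; left; apply/eqP.
rewrite /m; ring.
Qed.

Lemma expR1_ge2 : 2 <= expR 1 :> R.
Proof. by have := expR_ge1Dx (1 : R); lra. Qed.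

Lemma sqr_le_expR x : x ^+ 2 <= 4 * expR `|x|.
Proof.
have -> : `|x| = `|x| / 2 + `|x| / 2 by lra.
rewrite expRD -expr2 -[x ^+ 2]real_normK ?num_real//.
have h := expR_ge1Dx (`|x| / 2).
have x0 : 0 <= `|x| by [].
have : (`|x| / 2) ^+ 2 <= expR (`|x| / 2) ^+ 2.
  by rewrite lerXn2r ?nnegrE ?expR_ge0//; lra.
lra.
Qed.

End ExpInequalities.

Section Subgaussian.
Context {disp : measure_display} {T : measurableType disp} {R : realType}.
Variable P : probability T R.

Lemma measurable_expR_comp (f : T -> R) : measurable_fun setT f ->
  measurable_fun setT (fun w => expR (f w)).
Proof. by move=> mf; exact: measurableT_comp. Qed.

Lemma integral_le (f g : T -> R) :
  measurable_fun setT f -> measurable_fun setT g ->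
  (forall w, 0 <= f w) -> (forall w, f w <= g w) ->
  (\int[P]_w (f w)%:E <= \int[P]_w (g w)%:E)%E.
Proof.
move=> mf mg f0 fg; apply: ge0_le_integral => //=.
- by move=> w _; rewrite lee_fin.
- exact/measurable_EFinP.
- exact/measurable_EFinP.
- by move=> w _; rewrite lee_fin.
Qed.

Lemma integral_lin (f g : T -> R) a b :
  measurable_fun setT f -> measurable_fun setT g ->
  (forall w, 0 <= f w) -> (forall w, 0 <= g w) -> 0 <= a -> 0 <= b ->
  (\int[P]_w (a * f w + b * g w)%:E
    = a%:E * \int[P]_w (f w)%:E + b%:E * \int[P]_w (g w)%:E)%E.
Proof.
move=> mf mg f0 g0 a0 b0.
have mf' : measurable_fun setT (fun w => (f w)%:E) by exact/measurable_EFinP.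
have mg' : measurable_fun setT (fun w => (g w)%:E) by exact/measurable_EFinP.
under eq_integral do rewrite EFinD !EFinM.
rewrite ge0_integralD//=.
- rewrite !ge0_integralZl//=.
  + by move=> w _; rewrite lee_fin.
  + by move=> w _; rewrite lee_fin.
- by move=> w _; rewrite -EFinM lee_fin mulr_ge0.
- exact: measurable_funeM.
- by move=> w _; rewrite -EFinM lee_fin mulr_ge0.
- exact: measurable_funeM.
Qed.

(** Log-convexity of the map u |-> E exp u, i.e. Hoelder's inequality with
    exponents 1 / t and 1 / (1 - t): normalize both expectations to 1 and use
    the convexity of exp pointwise. *)
Lemma expectation_expR_convex (u v : T -> R) (t k l : R) :
  measurable_fun setT u -> measurable_fun setT v -> 0 <= t -> t <= 1 ->
  (\int[P]_w (expR (u w))%:E <= (expR k)%:E)%E ->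
  (\int[P]_w (expR (v w))%:E <= (expR l)%:E)%E ->
  (\int[P]_w (expR (t * u w + (1 - t) * v w))%:E
    <= (expR (t * k + (1 - t) * l))%:E)%E.
Proof.
move=> mu mv t0 t1 uk vl.
have t1' : 0 <= 1 - t by lra.
set e := expR (t * k + _).
have e0 : 0 <= e by exact: expR_ge0.
have mEu := measurable_expR_comp mu.
have mEv := measurable_expR_comp mv.
have muv : measurable_fun [set: T] (fun w => t * u w + (1 - t) * v w).
  by apply: measurable_funD; exact: measurable_funM.
have pw w : expR (t * u w + (1 - t) * v w)
    <= (e * t * expR (- k)) * expR (u w) + (e * (1 - t) * expR (- l)) * expR (v w).
  rewrite -!mulrA -mulrDr -expRD -expRD (mulrC e) -ler_pdivrMr ?expR_gt0//.
  rewrite -expRB; apply: le_trans (expR_convex _ _ t0 t1).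
  by rewrite ler_expR; lra.
have ca : 0 <= e * t * expR (- k) by rewrite !mulr_ge0 ?expR_ge0.
have cb : 0 <= e * (1 - t) * expR (- l) by rewrite !mulr_ge0 ?expR_ge0.
have e_ge0 (f : T -> R) w : 0 <= expR (f w) by exact: expR_ge0.
apply: le_trans (integral_le _ _ (e_ge0 _) pw) _; first exact: measurable_expR_comp.
  by apply: measurable_funD; exact: measurable_funM.
rewrite integral_lin//.
apply: (@le_trans _ _ ((e * t * expR (- k))%:E * (expR k)%:E +
   (e * (1 - t) * expR (- l))%:E * (expR l)%:E)%E).
  by apply: leeD; apply: lee_wpmul2l; rewrite ?lee_fin.
rewrite -!EFinM -EFinD lee_fin -!mulrA -!expRD !addNr expR0; lra.
Qed.


Lemma psi2norm_leW (X : T -> R) (C0 : R) : measurable_fun setT X ->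
  (psi2norm P X <= C0%:E)%E ->
  (\int[P]_w (expR (X w ^+ 2 / (`|C0| + 1) ^+ 2))%:E <= 2%:E)%E.
Proof.
move=> mX XC.
have : (psi2norm P X < (`|C0| + 1)%:E)%E.
  by rewrite (le_lt_trans XC)// lte_fin; have := ler_norm C0; lra.
move=> /ereal_inf_lt[_ [t [t0 Et] <-]]; rewrite lte_fin => tC.
apply: le_trans Et; rewrite unlock; apply: integral_le.
- apply: measurable_expR_comp; apply: measurable_funM => //.
  exact: measurable_funX.
- apply: measurable_expR_comp; apply: measurable_funM => //.
  exact: measurable_funX.
- by move=> w; exact: expR_ge0.
- move=> w; rewrite ler_expR ler_wpM2l ?sqr_ge0//.
  have C1 := lt_trans t0 tC.
  rewrite lef_pV2 ?posrE ?exprn_gt0//.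
  by rewrite lerXn2r ?nnegrE ?ltW.
Qed.

(** ** One variable with E exp (X^2 / g) <= 2 *)
Section OneVariable.
Variables (X : T -> R) (g : R).
Hypotheses (mX : measurable_fun setT X) (g1 : 1 <= g).
Hypothesis Xg : (\int[P]_w (expR (X w ^+ 2 / g))%:E <= 2%:E)%E.

Let g0 : 0 < g. Proof. exact: lt_le_trans ltr01 g1. Qed.

Let mX2 k : measurable_fun setT (fun w => k * X w ^+ 2).
Proof. by apply: measurable_funM => //; exact: measurable_funX. Qed.

Let mexpX2 : measurable_fun setT (fun w => expR (X w ^+ 2 / g)).
Proof.
apply: measurable_expR_comp; apply: measurable_funM => //.
exact: measurable_funX.
Qed.

Lemma integrable_expR_sqr :
  P.-integrable setT (EFin \o (fun w => expR (X w ^+ 2 / g))).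
Proof.
apply/integrableP; split; first exact/measurable_EFinP.
rewrite (eq_integral (fun w => (expR (X w ^+ 2 / g))%:E)); last first.
  by move=> w _ /=; rewrite ger0_norm ?expR_ge0.
by rewrite (le_lt_trans Xg)// ltry.
Qed.

Lemma integrable_le_expR (f : T -> R) k : measurable_fun setT f ->
  (forall w, `|f w| <= k * expR (X w ^+ 2 / g)) ->
  P.-integrable setT (EFin \o f).
Proof.
move=> mf fk.
have ik : P.-integrable setT (EFin \o (fun w => k * expR (X w ^+ 2 / g))).
  rewrite (_ : _ \o _ = fun w => (k%:E * (expR (X w ^+ 2 / g))%:E)%E).
    by apply: integrableZl => //; exact: integrable_expR_sqr.
  by apply/funext => w /=; rewrite EFinM.
apply: (le_integrable measurableT _ _ ik); first exact/measurable_EFinP.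
by move=> w _ /=; rewrite lee_fin (le_trans (fk w))// ler_norm.
Qed.

Lemma sqr_le_g_expR w : X w ^+ 2 <= g * expR (X w ^+ 2 / g).
Proof.
rewrite -ler_pdivrMl// mulrC; have := expR_ge1Dx (X w ^+ 2 / g); lra.
Qed.

Lemma integrable_sqr : P.-integrable setT (EFin \o (fun w => X w ^+ 2)).
Proof.
apply: (@integrable_le_expR _ g); first exact: measurable_funX.
by move=> w; rewrite ger0_norm ?sqr_ge0// sqr_le_g_expR.
Qed.

Lemma integrable_lin s : P.-integrable setT (EFin \o (fun w => s * X w)).
Proof.
apply: (@integrable_le_expR _ (`|s| * (1 + g))); first exact: measurable_funM.
move=> w; rewrite normrM -mulrA ler_wpM2l//.
have : 1 <= expR (X w ^+ 2 / g).
  by rewrite -expR0 ler_expR divr_ge0 ?sqr_ge0// ltW.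
have := sqr_le_g_expR w; have nX : `|X w| ^+ 2 = X w ^+ 2 by rewrite real_normK ?num_real.
have := sqr_ge0 (`|X w| - 1); have : 0 <= `|X w| by [].
set e := expR _; lra.
Qed.

(** For 2 s^2 g <= 1, exp x <= x + exp (2 x^2) and log-convexity apply; for
    larger s, s X <= g s^2 / 4 + X^2 / g. *)
Lemma mgf_subgaussian s : (\int[P]_w (X w)%:E = 0)%E ->
  (\int[P]_w (expR (s * X w))%:E <= (expR (4 * g * s ^+ 2))%:E)%E.
Proof.
move=> X0.
have e2 : (\int[P]_w (expR (X w ^+ 2 / g))%:E <= (expR 1)%:E)%E.
  by rewrite (le_trans Xg)// lee_fin expR1_ge2.
have s0 : 0 <= s ^+ 2 by exact: sqr_ge0.
have gs0 : 0 <= g * s ^+ 2 by rewrite mulr_ge0// ltW.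
have msX : measurable_fun setT (fun w => expR (s * X w)).
  by apply: measurable_expR_comp; exact: measurable_funM.
have [sg|sg] := leP (2 * s ^+ 2 * g) 1.
  have h : (\int[P]_w (expR (2 * (s * X w) ^+ 2))%:E
      <= (expR (2 * s ^+ 2 * g))%:E)%E.
    have mq : measurable_fun setT (fun w => X w ^+ 2 / g).
      by apply: measurable_funM => //; exact: measurable_funX.
    have cst0 : (\int[P]_w (expR 0)%:E <= (expR (0 : R))%:E)%E.
      by rewrite integral_cst// [X in (_ * X)%E]probability_setT mule1.
    have t0 : 0 <= 2 * s ^+ 2 * g by lra.
    have := @expectation_expR_convex _ (cst 0) (2 * s ^+ 2 * g) _ _ mq
      (measurable_cst _) t0 sg e2 cst0.
    rewrite (_ : 2 * s ^+ 2 * g * 1 + _ = 2 * s ^+ 2 * g); last by ring.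
    congr (_ <= _)%E.
    apply: eq_integral => w _; congr (expR _)%:E.
    by rewrite /=; field; rewrite gt_eqF.
  apply: (@le_trans _ _ (\int[P]_w (s * X w + expR (2 * (s * X w) ^+ 2))%:E)%E).
    apply: integral_le => //.
    - apply: measurable_funD; first exact: measurable_funM.
      apply: measurable_expR_comp; apply: measurable_funM => //.
      by apply: measurable_funX; exact: measurable_funM.
    - by move=> w; exact: expR_le_sqr.
  have mE : measurable_fun setT (fun w => expR (2 * (s * X w) ^+ 2)).
    apply: measurable_expR_comp; apply: measurable_funM => //.
    by apply: measurable_funX; exact: measurable_funM.
  under eq_integral do rewrite EFinD.
  rewrite integralD//=; last 2 first.
  - exact: integrable_lin.
  - apply/integrableP; split; first exact/measurable_EFinP.
    rewrite (eq_integral (fun w => (expR (2 * (s * X w) ^+ 2))%:E)); last first.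
      by move=> w _ /=; rewrite ger0_norm ?expR_ge0.
    by rewrite (le_lt_trans h)// ltry.
  have -> : (\int[P]_w (s * X w)%:E = 0)%E.
    under eq_integral do rewrite EFinM.
    rewrite integralZl// ?X0 ?mule0//.
    have := integrable_lin 1; under eq_fun do rewrite mul1r; exact.
  by rewrite add0e (le_trans h)// lee_fin ler_expR; lra.
apply: (@le_trans _ _ (\int[P]_w (expR (g * s ^+ 2 / 4) * expR (X w ^+ 2 / g)
   + 0 * 1)%:E)%E).
  apply: integral_le => //.
  - by apply: measurable_funD => //; exact: measurable_funM.
  - move=> w; rewrite mul0r addr0 -expRD ler_expR.
    have gX : X w ^+ 2 / g = g * (X w / g) ^+ 2 by field; rewrite gt_eqF.
    have sX : s * X w = g * (s * (X w / g)) by field; rewrite gt_eqF.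
    have : 0 <= g * (s / 2 - X w / g) ^+ 2 by rewrite mulr_ge0 ?sqr_ge0// ltW.
    rewrite gX sX; lra.
rewrite integral_lin// ?expR_ge0//.
rewrite mul0e adde0.
apply: (@le_trans _ _ ((expR (g * s ^+ 2 / 4))%:E * (expR 1)%:E)%E).
  by rewrite lee_wpmul2l// lee_fin expR_ge0.
by rewrite -EFinM -expRD lee_fin ler_expR; lra.
Qed.

(** Up to the factor exp a, X is dominated by a centered Gaussian variable of
    variance 8 g, for which the exponent would be the second term exactly.  The
    proof uses log-convexity with weights a on X^2 / (16 g) and 1 - a on the
    linear term; the scale 16 g is four times the constant of the linear bound,
    which makes the second term exactly the one of the Schur complement. *)
Lemma mgf_quadratic a s : (\int[P]_w (X w)%:E = 0)%E ->
  0 <= a -> a <= 2^-1 ->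
  (\int[P]_w (expR ((a * X w ^+ 2 + 2 * s * X w) / (16 * g)))%:E
     <= (expR (a + s ^+ 2 / (16 * g * (1 - a))))%:E)%E.
Proof.
move=> X0 a0 a2; have b0 : 0 < 1 - a by lra.
pose r := 2 * s / (16 * g * (1 - a)).
have e2 : (\int[P]_w (expR (X w ^+ 2 / (16 * g)))%:E <= (expR 1)%:E)%E.
  apply: (@le_trans _ _ (2%:E)); last by rewrite lee_fin expR1_ge2.
  apply: le_trans Xg; apply: integral_le => //.
  - apply: measurable_expR_comp; apply: measurable_funM => //.
    exact: measurable_funX.
  - move=> w; rewrite ler_expR ler_wpM2l ?sqr_ge0// lef_pV2 ?posrE ?mulr_gt0//.
    by rewrite ler_peMl ?ler1n// ltW.
have := @expectation_expR_convex (fun w => X w ^+ 2 / (16 * g))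
  (fun w => r * X w) a 1 _ _ _ a0 _ e2 (mgf_subgaussian r X0).
have -> : a * 1 + (1 - a) * (4 * g * r ^+ 2) = a + s ^+ 2 / (16 * g * (1 - a)).
  by rewrite /r; field; rewrite !gt_eqF.
move=> h.
rewrite (eq_integral (fun w =>
   (expR (a * (X w ^+ 2 / (16 * g)) + (1 - a) * (r * X w)))%:E)); last first.
  move=> w _; congr (expR _)%:E.
  by rewrite /r; field; rewrite !gt_eqF.
apply: h; last lra.
- by apply: measurable_funM => //; exact: measurable_funX.
- exact: measurable_funM.
Qed.

(** The form of Bernstein's bound for X^2 - 1, which is only exponentially
    integrable: this restricts x to a bounded interval. *)
Lemma mgf_centered_sqr x : (\int[P]_w (X w ^+ 2)%:E = 1)%E ->
  `|x| <= (2 * g)^-1 ->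
  (\int[P]_w (expR (x * (X w ^+ 2 - 1)))%:E
     <= (expR (128 * expR 1 * g ^+ 2 * x ^+ 2))%:E)%E.
Proof.
move=> X1 xg.
pose k := 64 * g ^+ 2 * x ^+ 2 * expR 1.
have k0 : 0 <= k.
  by rewrite mulr_ge0 ?expR_ge0// -mulrA -exprMn mulr_ge0// sqr_ge0.
have mY : measurable_fun setT (fun w => x * (X w ^+ 2 - 1)).
  apply: measurable_funM => //; apply: measurable_funB => //.
  exact: measurable_funX.
pose F w := (1 - x) + x * X w ^+ 2 + k * expR (X w ^+ 2 / g).
(* With Y = X^2 - 1, the factor Y^2 is absorbed by 16 g^2 exp (|Y| / (2 g)), and
   x Y is at most |Y| / (2 g): together exp (|Y| / g) <= e exp (X^2 / g). *)
have pw w : expR (x * (X w ^+ 2 - 1)) <= F w.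
  set y := X w ^+ 2 - 1.
  apply: (le_trans (expR_le_quad _)).
  have -> : F w = 1 + x * y + k * expR (X w ^+ 2 / g) by rewrite /F /y; ring.
  rewrite lerD2l.
  have y2 := sqr_le_expR (y / (2 * g)).
  have g20 : 0 < 2 * g by rewrite mulr_gt0.
  have nE : `|y / (2 * g)| = `|y| * (2 * g)^-1.
    by rewrite normrM (@ger0_norm _ (_^-1))// invr_ge0 ltW.
  have y3 : y ^+ 2 <= 16 * g ^+ 2 * expR (`|y| * (2 * g)^-1).
    rewrite -nE; have -> : y = 2 * g * (y / (2 * g)) by field; rewrite gt_eqF.
    rewrite exprMn [(_ * (y / _)) / _]mulrAC divff ?gt_eqF// mul1r.
    have : 0 <= (2 * g) ^+ 2 * (4 * expR `|y / (2 * g)| - (y / (2 * g)) ^+ 2).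
      by rewrite mulr_ge0 ?sqr_ge0// subr_ge0.
    lra.
  have y4 : expR `|x * y| <= expR (`|y| * (2 * g)^-1).
    by rewrite ler_expR normrM mulrC ler_wpM2l.
  apply: (@le_trans _ _ (4 * x ^+ 2 * (16 * g ^+ 2 * expR (`|y| * (2 * g)^-1))
      * expR (`|y| * (2 * g)^-1))).
    rewrite exprMn; apply: ler_pM => //.
    - by rewrite -exprMn mulr_ge0// sqr_ge0.
    - rewrite mulrA; apply: ler_wpM2l => //.
      by rewrite mulr_ge0// sqr_ge0.
  have -> : 4 * x ^+ 2 * (16 * g ^+ 2 * expR (`|y| * (2 * g)^-1))
      * expR (`|y| * (2 * g)^-1)
      = 64 * g ^+ 2 * x ^+ 2 * expR (`|y| * (2 * g)^-1 + `|y| * (2 * g)^-1).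
    by rewrite expRD; ring.
  have c0 : 0 <= 64 * g ^+ 2 * x ^+ 2.
    by rewrite -mulrA -exprMn mulr_ge0// sqr_ge0.
  rewrite /k -[leRHS]mulrA; apply: ler_wpM2l => //.
  rewrite -expRD ler_expR.
  have -> : `|y| * (2 * g)^-1 + `|y| * (2 * g)^-1 = `|y| / g.
    by field; rewrite gt_eqF.
  have y1 : `|y| <= 1 + X w ^+ 2.
    by rewrite ler_norml /y; have := sqr_ge0 (X w) => ?; apply/andP; split; lra.
  apply: (@le_trans _ _ ((1 + X w ^+ 2) / g)).
    by rewrite ler_wpM2r// invr_ge0 ltW.
  by rewrite mulrDl mul1r lerD2r invf_le1.
have mF : measurable_fun setT F.
  apply: measurable_funD; last exact: measurable_funM.
  by apply: measurable_funD => //; exact: mX2.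
apply: (@le_trans _ _ (\int[P]_w (F w)%:E)%E).
  by apply: integral_le => //; exact: measurable_expR_comp.
have i1 : P.-integrable setT (EFin \o (fun w => x * X w ^+ 2)).
  rewrite (_ : _ \o _ = fun w => (x%:E * (X w ^+ 2)%:E)%E).
    by apply: integrableZl => //; exact: integrable_sqr.
  by apply/funext => w /=; rewrite EFinM.
have i0 : P.-integrable setT (EFin \o cst (1 - x)).
  exact: finite_measure_integrable_cst.
have i2 : P.-integrable setT (EFin \o (fun w => k * expR (X w ^+ 2 / g))).
  rewrite (_ : _ \o _ = fun w => (k%:E * (expR (X w ^+ 2 / g))%:E)%E).
    by apply: integrableZl => //; exact: integrable_expR_sqr.
  by apply/funext => w /=; rewrite EFinM.
under eq_integral do rewrite /F !EFinD.
rewrite integralD//=; last exact: (integrableD measurableT i0 i1).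
rewrite integralD//= integral_cst// [X in (_ * X)%E]probability_setT mule1.
have -> : (\int[P]_w (x * X w ^+ 2)%:E = x%:E)%E.
  under eq_integral do rewrite EFinM.
  by rewrite integralZl// ?X1 ?mule1//; exact: integrable_sqr.
have -> : (\int[P]_w (k * expR (X w ^+ 2 / g))%:E
    = k%:E * \int[P]_w (expR (X w ^+ 2 / g))%:E)%E.
  under eq_integral do rewrite EFinM.
  by rewrite integralZl//; exact: integrable_expR_sqr.
apply: (@le_trans _ _ ((1 - x)%:E + x%:E + k%:E * 2%:E)%E).
  by rewrite leeD2l// lee_wpmul2l// lee_fin.
rewrite -EFinM -!EFinD lee_fin; apply: le_trans (expR_ge1Dx _).
by rewrite /k; lra.
Qed.

End OneVariable.

End Subgaussian.

(** * Exponential moments of quadratic forms *)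

Section MeasurableForms.
Context {d : measure_display} {S : measurableType d} {R : realType}.

Lemma measurable_dotv n (u : 'cV[R]_n) (f : 'I_n -> S -> R) :
  (forall i, measurable_fun setT (f i)) ->
  measurable_fun setT (fun s => dotv u (\col_i f i s)).
Proof.
move=> mf; rewrite (_ : (fun s => _) = fun s => \sum_i u i 0 * f i s).
  by apply: measurable_sum => i; exact: measurable_funM.
by apply/funext => s; rewrite dotvE; apply: eq_bigr => i _; rewrite mxE.
Qed.

Lemma measurable_qform n (N : 'M[R]_n) (f : 'I_n -> S -> R) :
  (forall i, measurable_fun setT (f i)) ->
  measurable_fun setT (fun s => qform N (\col_i f i s)).
Proof.
move=> mf.
rewrite (_ : (fun s => _) = fun s => \sum_i f i s * \sum_j N i j * f j s).
  apply: measurable_sum => i; apply: measurable_funM => //.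
  by apply: measurable_sum => j; exact: measurable_funM.
apply/funext => s; rewrite /qform dotvE; apply: eq_bigr => i _; rewrite !mxE.
by congr (_ * _); apply: eq_bigr => j _; rewrite mxE.
Qed.

End MeasurableForms.

Section HansonWright.
Context {disp : measure_display} {T : measurableType disp} {R : realType}.
Variable P : probability T R.
Variable g : R.
Hypothesis g1 : 1 <= g.

Let g0 : 0 < g. Proof. exact: lt_le_trans ltr01 g1. Qed.

Lemma col_consE n (F : 'I_n.+1 -> R) :
  \col_i F i = col_mx (F ord0)%:M (\col_i F (lift ord0 i)) :> 'cV[R]_(1 + n).
Proof.
apply/colP => i; rewrite !mxE.
case: splitP => j ij; rewrite !mxE.
  by rewrite !ord1 eqxx mulr1n; congr (F _); apply/val_inj; rewrite /= ij ord1.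
by congr (F _); apply/val_inj; rewrite /= ij.
Qed.

(** Integrating out the first coordinate replaces N by schur N at the price of
    the factor exp (N 0 0).  Nonnegativity of the diagonal is what allows the
    one-variable bound, and elimination preserves it. *)
Lemma mgf_qform n (Z : 'I_n -> {RV P >-> R}) (N : 'M[R]_n) :
  mutually_independent Z ->
  (forall i, \int[P]_w (Z i w)%:E = 0)%E ->
  (forall i, \int[P]_w (expR (Z i w ^+ 2 / g))%:E <= 2%:E)%E ->
  N^T = N -> (forall i, 0 <= N i i) -> halfbounded N ->
  (\int[P]_w (expR (qform N (\col_i Z i w) / (16 * g)))%:E
    <= (expR (pivots N))%:E)%E.
Proof.
elim: n Z N => [|n IH] Z N indZ Z0 Zg symN dN bN.
  rewrite (eq_integral (fun _ => (expR 0)%:E)); last first.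
    by move=> w _; rewrite /qform dotvE big_ord0 mul0r.
  by rewrite integral_cst// [X in (_ * X)%E]probability_setT mule1.
pose Z' (i : 'I_n) := Z (lift ord0 i).
have symS := schur_sym symN.
have bS := halfbounded_schur symN bN.
have a2 := halfbounded_head symN bN.
have dS := diag_schur_ge0 a2 dN.
set a := (N : 'M[R]_(1 + n)) 0 0 in a2.
have a0 : 0 <= a := dN ord0.
have b1 : 1 - a != 0 by rewrite gt_eqF//; lra.
pose u : 'cV[R]_n := dlsubmx (N : 'M[R]_(1 + n)).
pose N' : 'M[R]_n := drsubmx (N : 'M[R]_(1 + n)).
pose q (z : R) (y : 'cV[R]_n) := a * z ^+ 2 + 2 * z * dotv u y + qform N' y.
pose h (zy : R * n.-tuple R) : \bar R :=
  (expR (q zy.1 (\col_i tnth zy.2 i) / (16 * g)))%:E.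
have mtn i : measurable_fun setT (fun zy : R * n.-tuple R => tnth zy.2 i).
  exact: (measurableT_comp (measurable_tnth i) measurable_snd).
have mh : measurable_fun setT h.
  apply/measurable_EFinP; apply: measurableT_comp => //.
  apply: measurable_funM => //; apply: measurable_funD.
    apply: measurable_funD; first by apply: measurable_funM => //; exact: measurable_funX.
    apply: measurable_funM; last exact: (measurable_dotv u mtn).
    exact: measurable_funM.
  exact: (measurable_qform N' mtn).
have colE w : \col_i tnth (tuple_rv Z' w) i = \col_i Z' i w.
  by apply/colP => i; rewrite !mxE tnth_mktuple.
have qE w : qform N (\col_i Z i w) = q (Z ord0 w) (\col_i Z' i w).
  by rewrite col_consE {1}(sym_blockE symN) qform_block.
rewrite (eq_integral (fun w => h (Z ord0 w, tuple_rv Z' w))); last first.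
  by move=> w _; rewrite qE /h/= colE.
pose f (y : n.-tuple R) : \bar R :=
  ((expR a)%:E * (expR (qform (schur N) (\col_i tnth y i) / (16 * g)))%:E)%E.
have mtn' i : measurable_fun setT (fun y : n.-tuple R => tnth y i).
  exact: measurable_tnth.
have mf : measurable_fun setT f.
  apply: measurable_funeM; apply/measurable_EFinP; apply: measurableT_comp => //.
  by apply: measurable_funM => //; exact: measurable_qform.
apply: (@le_trans _ _ (\int[P]_w f (tuple_rv Z' w))%E).
  apply: independent_integral_le => //.
    by move=> zy; rewrite lee_fin expR_ge0.
  move=> y'; rewrite /h/= /f; set y := \col_i tnth y' i.
  rewrite (eq_integral (fun w => (expR (qform N' y / (16 * g)) *
    expR ((a * Z ord0 w ^+ 2 + 2 * dotv u y * Z ord0 w) / (16 * g)) + 0 * 1)%:E));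
    last first.
    move=> w _; rewrite mul0r addr0 -expRD; congr (expR _)%:E.
    by rewrite /q; field; rewrite gt_eqF.
  rewrite integral_lin ?expR_ge0//; last 1 first.
  - apply: measurableT_comp => //; apply: measurable_funM => //.
    apply: measurable_funD; apply: measurable_funM => //.
    exact: measurable_funX.
  rewrite mul0e adde0.
  apply: (@le_trans _ _ ((expR (qform N' y / (16 * g)))%:E *
     (expR (a + dotv u y ^+ 2 / (16 * g * (1 - a))))%:E)%E).
    apply: lee_wpmul2l; first by rewrite lee_fin expR_ge0.
    exact: mgf_quadratic.
  rewrite -!EFinM lee_fin -!expRD ler_expR qform_schur -/N' -/u -/a.
  rewrite le_eqVlt; apply/orP; left; apply/eqP; field.
  by rewrite b1 gt_eqF.
rewrite /f ge0_integralZl//=; last 1 first.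
- apply/measurable_EFinP; apply: measurableT_comp => //.
  apply: measurable_funM => //.
  under eq_fun do rewrite colE.
  exact: measurable_qform.
have := IH Z' (schur N) (independent_tail indZ) (fun i => Z0 _) (fun i => Zg _)
  symS dS bS.
rewrite expRD EFinM => h1; apply: lee_wpmul2l; first by rewrite lee_fin expR_ge0.
by under eq_integral do rewrite colE.
Qed.


Lemma mgf_diagonal n (Z : 'I_n -> {RV P >-> R}) (x : 'I_n -> R) :
  mutually_independent Z ->
  (forall i, \int[P]_w (Z i w ^+ 2)%:E = 1)%E ->
  (forall i, \int[P]_w (expR (Z i w ^+ 2 / g))%:E <= 2%:E)%E ->
  (forall i, `|x i| <= (2 * g)^-1) ->
  (\int[P]_w (expR (\sum_i x i * (Z i w ^+ 2 - 1)))%:E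
    <= (expR (128 * expR 1 * g ^+ 2 * \sum_i x i ^+ 2))%:E)%E.
Proof.
elim: n Z x => [|n IH] Z x indZ Z1 Zg xg.
  rewrite (eq_integral (fun _ => (expR 0)%:E)); last first.
    by move=> w _; rewrite big_ord0.
  by rewrite big_ord0 mulr0 integral_cst// [X in (_ * X)%E]probability_setT mule1.
pose Z' (i : 'I_n) := Z (lift ord0 i).
pose s (y : 'I_n -> R) := \sum_i x (lift ord0 i) * (y i ^+ 2 - 1).
pose h (zy : R * n.-tuple R) : \bar R :=
  (expR (x ord0 * (zy.1 ^+ 2 - 1) + s (tnth zy.2)))%:E.
set K := 128 * expR 1 * g ^+ 2.
pose f (y : n.-tuple R) : \bar R :=
  ((expR (K * x ord0 ^+ 2))%:E * (expR (s (tnth y)))%:E)%E.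
have ms : measurable_fun setT (fun y : n.-tuple R => s (tnth y)).
  apply: measurable_sum => i; apply: measurable_funM => //.
  apply: measurable_funB => //; apply: measurable_funX.
  exact: measurable_tnth.
have mh : measurable_fun setT h.
  apply/measurable_EFinP; apply: measurableT_comp => //.
  apply: measurable_funD; last exact: (measurableT_comp ms measurable_snd).
  apply: measurable_funM => //; apply: measurable_funB => //.
  exact: measurable_funX.
have mes : measurable_fun setT (fun y : n.-tuple R => (expR (s (tnth y)))%:E).
  by apply/measurable_EFinP; apply: measurableT_comp.
have mf : measurable_fun setT f by exact: measurable_funeM.
have sE w : s (tnth (tuple_rv Z' w)) = \sum_i x (lift ord0 i) * (Z' i w ^+ 2 - 1).
  by apply: eq_bigr => i _; rewrite tnth_mktuple.
rewrite (eq_integral (fun w => h (Z ord0 w, tuple_rv Z' w))); last first.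
  by move=> w _; rewrite big_ord_recl /h/= sE.
apply: (@le_trans _ _ (\int[P]_w f (tuple_rv Z' w))%E).
  apply: independent_integral_le => //.
    by move=> zy; rewrite lee_fin expR_ge0.
  move=> y; rewrite /h/= /f.
  rewrite (eq_integral (fun w => (expR (s (tnth y)) *
    expR (x ord0 * (Z ord0 w ^+ 2 - 1)) + 0 * 1)%:E)); last first.
    by move=> w _; rewrite mul0r addr0 -expRD addrC.
  rewrite integral_lin ?expR_ge0//; last 1 first.
  - apply: measurableT_comp => //; apply: measurable_funM => //.
    by apply: measurable_funB => //; exact: measurable_funX.
  rewrite mul0e adde0 muleC lee_wpmul2r ?lee_fin ?expR_ge0//.
  exact: mgf_centered_sqr.
rewrite /f ge0_integralZl//=; last 1 first.
- apply/measurable_EFinP; apply: measurableT_comp => //.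
  exact: (measurableT_comp ms).
have := IH Z' (fun i => x (lift ord0 i)) (independent_tail indZ)
  (fun i => Z1 _) (fun i => Zg _) (fun i => xg _).
rewrite big_ord_recl mulrDr expRD EFinM => h1.
apply: lee_wpmul2l; first by rewrite lee_fin expR_ge0.
by under eq_integral do rewrite sE.
Qed.

End HansonWright.

(** * The Hanson-Wright inequality *)

Section Tail.
Context {disp : measure_display} {T : measurableType disp} {R : realType}.
Variables (P : probability T R) (g : R) (n : nat) (Z : 'I_n -> {RV P >-> R}).
Hypotheses (g1 : 1 <= g) (indZ : mutually_independent Z).
Hypothesis Z0 : (forall i, \int[P]_w (Z i w)%:E = 0)%E.
Hypothesis Z1 : (forall i, \int[P]_w (Z i w ^+ 2)%:E = 1)%E.
Hypothesis Zg : (forall i, \int[P]_w (expR (Z i w ^+ 2 / g))%:E <= 2%:E)%E.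
Variables (A : 'M[R]_n) (o : R).
Hypotheses (symA : A^T = A) (Ao : forall x, `|qform A x| <= o * dotv x x).

Let g0 : 0 < g. Proof. exact: lt_le_trans ltr01 g1. Qed.

Definition centered_form (w : T) : R := qform A (\col_i Z i w) - \tr A.

Lemma measurable_centered_form : measurable_fun setT centered_form.
Proof. by apply: measurable_funB => //; exact: measurable_qform. Qed.

Lemma diag_le i : `|A i i| <= o.
Proof.
have := Ao (delta_mx i 0); rewrite /qform -colE !dotvE (bigD1 i)//= !mxE !eqxx.
rewrite big1 ?addr0; last by move=> j ji; rewrite !mxE (negbTE ji) mul0r.
rewrite (bigD1 i)//= !mxE !eqxx big1 ?addr0; last first.
  by move=> j ji; rewrite !mxE (negbTE ji) mul0r.
by rewrite !mul1r mulr1.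
Qed.

Definition offdiag : 'M[R]_n := \matrix_(i, j) (if i == j then 0 else A i j).

Lemma offdiag_sym : offdiag^T = offdiag.
Proof.
apply/matrixP => i j; rewrite !mxE eq_sym; case: eqP => // _.
by rewrite -[in RHS]symA mxE.
Qed.

Lemma qform_offdiag x : qform A x = qform offdiag x + \sum_i A i i * x i 0 ^+ 2.
Proof.
rewrite /qform !dotvE -big_split/=; apply: eq_bigr => i _.
rewrite !mxE (bigD1 i)//= [in RHS](bigD1 i)//= !mxE eqxx mul0r add0r.
rewrite [X in _ = _ * X + _](eq_bigr (fun j => A i j * x j 0)); first by ring.
by move=> j ji; rewrite !mxE eq_sym (negbTE ji).
Qed.

(** The diagonal and the off-diagonal part of the form are dependent, but by
    log-convexity with weight 1/2 it is enough to bound each of them at 2 l. *)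
Lemma mgf_centered_form l : 128 * g * (`|l| * o) <= 1 ->
  (\int[P]_w (expR (l * centered_form w))%:E
     <= (expR (2048 * expR 1 * g ^+ 2 * (l ^+ 2 * sqfrob A)))%:E)%E.
Proof.
move=> lo; set B := 2048 * _ * _ * _.
have e1 := expR1_ge2 R.
have F0 : 0 <= sqfrob A.
  by apply: sumr_ge0 => i _; apply: sumr_ge0 => j _; exact: sqr_ge0.
pose x i := 2 * l * A i i.
pose u w := \sum_i x i * (Z i w ^+ 2 - 1).
pose N := (32 * g * l) *: offdiag.
pose v w := qform N (\col_i Z i w) / (16 * g).
have mu : measurable_fun setT u.
  apply: measurable_sum => i; apply: measurable_funM => //.
  by apply: measurable_funB => //; exact: measurable_funX.
have mv : measurable_fun setT v.
  by apply: measurable_funM => //; exact: measurable_qform.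
have lo' i : `|l| * `|A i i| <= `|l| * o by rewrite ler_wpM2l// diag_le.
have gi : g * (`|l| * o) <= 128^-1 by lra.
have uB : (\int[P]_w (expR (u w))%:E <= (expR B)%:E)%E.
  apply: le_trans (mgf_diagonal g1 indZ Z1 Zg _) _.
    move=> i; rewrite /x -mulrA normrM normrM normr_nat.
    rewrite -[(2 * g)^-1]mul1r ler_pdivlMr ?mulr_gt0//.
    have : g * (`|l| * `|A i i|) <= g * (`|l| * o) by rewrite ler_wpM2l// ltW.
    lra.
  rewrite lee_fin ler_expR /B.
  have -> : 2048 * expR 1 * g ^+ 2 * (l ^+ 2 * sqfrob A)
      = 128 * expR 1 * g ^+ 2 * (16 * (l ^+ 2 * sqfrob A)) by ring.
  apply: ler_wpM2l.
    by rewrite mulr_ge0 ?sqr_ge0// mulr_ge0// expR_ge0.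
  have h : \sum_i A i i ^+ 2 <= sqfrob A.
    apply: ler_sum => i _; rewrite (bigD1 i)//= lerDl.
    by apply: sumr_ge0 => j _; exact: sqr_ge0.
  have -> : \sum_i x i ^+ 2 = 4 * (l ^+ 2 * \sum_i A i i ^+ 2).
    by rewrite !mulr_sumr; apply: eq_bigr => i _; rewrite /x; ring.
  have : l ^+ 2 * \sum_i A i i ^+ 2 <= l ^+ 2 * sqfrob A.
    by rewrite ler_wpM2l// sqr_ge0.
  have : 0 <= l ^+ 2 * sqfrob A by rewrite mulr_ge0// sqr_ge0.
  lra.
have symN : N^T = N by rewrite /N linearZ/= offdiag_sym.
have dN i : N i i = 0 by rewrite !mxE eqxx mulr0.
have bN : halfbounded N.
  move=> y; rewrite /N qformZ.
  have y0 := dotv_ge0 y.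
  have offE : `|qform offdiag y| <= 2 * o * dotv y y.
    have -> : qform offdiag y = qform A y - \sum_i A i i * y i 0 ^+ 2.
      by rewrite qform_offdiag addrK.
    apply: le_trans (ler_normB _ _) _.
    have : `|\sum_i A i i * y i 0 ^+ 2| <= o * dotv y y.
      apply: le_trans (ler_norm_sum _ _ _) _.
      rewrite dotvE mulr_sumr; apply: ler_sum => i _.
      by rewrite normrM -expr2 (ger0_norm (sqr_ge0 _)) ler_wpM2r ?sqr_ge0// diag_le.
    have := Ao y; lra.
  apply: le_trans (ler_norm _) _; rewrite !normrM !normr_nat (gtr0_norm g0).
  have h1 : `|l| * `|qform offdiag y| <= `|l| * (2 * o * dotv y y).
    by rewrite ler_wpM2l.
  have h2 : g * (`|l| * `|qform offdiag y|) <= g * (`|l| * (2 * o * dotv y y)).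
    by rewrite ler_wpM2l// ltW.
  have h3 : g * (`|l| * o) * dotv y y <= 128^-1 * dotv y y by rewrite ler_wpM2r.
  lra.
have vB : (\int[P]_w (expR (v w))%:E <= (expR B)%:E)%E.
  apply: le_trans (mgf_qform g1 indZ Z0 Zg symN _ bN) _.
    by move=> i; rewrite dN.
  rewrite lee_fin ler_expR; apply: le_trans (pivots_le symN bN) _.
  rewrite [\tr N]big1 ?add0r; last by move=> i _; rewrite dN.
  have -> : B = 2 * ((32 * g * l) ^+ 2 * (expR 1 * sqfrob A)) by rewrite /B; ring.
  rewrite ler_pM2l//.
  apply: (@le_trans _ _ ((32 * g * l) ^+ 2 * sqfrob A)).
    rewrite /sqfrob mulr_sumr; apply: ler_sum => i _.
    rewrite mulr_sumr; apply: ler_sum => j _.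
    rewrite /N mxE exprMn ler_wpM2l ?sqr_ge0// mxE.
    by case: eqP => //; rewrite expr0n/= sqr_ge0.
  rewrite ler_wpM2l ?sqr_ge0// ler_peMl//; lra.
have half0 : (0 : R) <= 2^-1 by lra.
have half1 : (2^-1 : R) <= 1 by lra.
have := expectation_expR_convex mu mv half0 half1 uB vB.
rewrite (_ : 2^-1 * B + _ = B); last by field.
congr (_ <= _)%E; apply: eq_integral => w _; congr (expR _)%:E.
rewrite /u /v /N /centered_form qformZ qform_offdiag /mxtrace.
have -> : \sum_i x i * (Z i w ^+ 2 - 1)
    = 2 * l * (\sum_i A i i * (\col_i Z i w) i 0 ^+ 2 - \sum_i A i i).
  rewrite -sumrB mulr_sumr; apply: eq_bigr => i _; rewrite mxE /x; ring.
by field; rewrite gt_eqF.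
Qed.

Lemma chernoff_bound (W : T -> R) (l t B : R) : measurable_fun setT W -> 0 < l ->
  (\int[P]_w (expR (l * W w))%:E <= (expR B)%:E)%E ->
  (P [set w | (t <= W w)%R] <= (expR (B - l * t))%:E)%E.
Proof.
move=> mW l0 WB.
pose X : {RV P >-> R} := HB.pack W (isMeasurableFun.Build _ _ _ _ W mW).
apply: le_trans (chernoff X t l0) _.
rewrite expRD EFinM lee_wpmul2r ?lee_fin ?expR_ge0//.
apply: le_trans WB; rewrite /mmt_gen_fun unlock.
by under eq_integral do rewrite /= mulrC.
Qed.

Lemma measurable_superlevel (t : R) (W : T -> R) : measurable_fun setT W ->
  measurable [set w | t <= W w].
Proof.
move=> mW; have := mW measurableT _ (measurable_itv `[t, +oo[).
rewrite setTI (_ : _ @^-1` _ = [set w | t <= W w])//.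
by apply/seteqP; split=> w /=; rewrite in_itv/= andbT.
Qed.

(** Chernoff's method for the form and its opposite.  The parameter l stays free
    because the best choice depends on the regime of t. *)
Lemma hanson_wright (l t : R) : 0 < l -> 128 * g * (l * o) <= 1 ->
  (P [set w | (t <= `|centered_form w|)%R]
    <= (2 * expR (2048 * expR 1 * g ^+ 2 * (l ^+ 2 * sqfrob A) - l * t))%:E)%E.
Proof.
move=> l0 lo; set B := 2048 * _ * _ * _.
have mW := measurable_centered_form.
have mW' : measurable_fun setT (fun w => - centered_form w).
  exact: measurableT_comp.
have b1 : (P [set w | (t <= centered_form w)%R] <= (expR (B - l * t))%:E)%E.
  apply: chernoff_bound => //; apply: mgf_centered_form.
  by rewrite gtr0_norm.
have b2 : (P [set w | (t <= - centered_form w)%R] <= (expR (B - l * t))%:E)%E.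
  apply: chernoff_bound => //.
  have := @mgf_centered_form (- l); rewrite normrN gtr0_norm// sqrrN => /(_ lo).
  by under eq_integral do rewrite mulNr -mulrN.
have m1 := measurable_superlevel t mW; have m2 := measurable_superlevel t mW'.
rewrite (_ : [set w | _] = [set w | t <= centered_form w] `|`
    [set w | t <= - centered_form w]); last first.
  by apply/seteqP; split=> w /=; rewrite real_ler_normr ?num_real// => /orP.
apply: le_trans (measureU2 _ _ _) _ => //.
apply: (le_trans (leeD b1 b2)).
by rewrite -EFinD lee_fin mulr2n mulrDl mul1r.
Qed.

End Tail.

(** * Operator and Frobenius norms *)

Section MatrixNorms.
Variable R : realType.

Lemma mxinner_sqfrob m n (M : 'M[R]_(m, n)) : mxinner M M = sqfrob M.
Proof.
rewrite /mxinner /mxtrace /sqfrob exchange_big/=; apply: eq_bigr => j _.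
by rewrite mxE; apply: eq_bigr => i _; rewrite mxE expr2.
Qed.

Lemma sqfrob_ge0 m n (M : 'M[R]_(m, n)) : 0 <= sqfrob M.
Proof. by apply: sumr_ge0 => i _; apply: sumr_ge0 => j _; exact: sqr_ge0. Qed.

Lemma sqfrob_tr m n (M : 'M[R]_(m, n)) : sqfrob M^T = sqfrob M.
Proof.
rewrite /sqfrob exchange_big/=; apply: eq_bigr => i _.
by apply: eq_bigr => j _; rewrite mxE.
Qed.

Lemma sqfrob_col m n (M : 'M[R]_(m, n)) :
  sqfrob M = \sum_j dotv (col j M) (col j M).
Proof.
rewrite /sqfrob exchange_big/=; apply: eq_bigr => j _.
by rewrite dotvE; apply: eq_bigr => i _; rewrite !mxE expr2.
Qed.

Lemma sqr_fnorm m n (M : 'M[R]_(m, n)) : fnorm M ^+ 2 = sqfrob M.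
Proof. by rewrite /fnorm mxinner_sqfrob sqr_sqrtr// sqfrob_ge0. Qed.

Lemma sqfrob_cV n (x : 'cV[R]_n) : sqfrob x = dotv x x.
Proof. by rewrite sqfrob_col big_ord1 col_id. Qed.

Lemma dotv_cauchy_schwarz n (x y : 'cV[R]_n) :
  dotv x y ^+ 2 <= dotv x x * dotv y y.
Proof.
have [y0|y0] := eqVneq (dotv y y) 0.
  by rewrite (dotv_eq0 y0) /dotv !mulmx0 mxE mulr0 expr0n.
have yp : 0 < dotv y y by rewrite lt_neqAle eq_sym y0 dotv_ge0.
have := dotv_ge0 (dotv y y *: x - dotv x y *: y).
rewrite dotvBr !dotvZr !(dotvC (_ - _)) !dotvBr !dotvZr (dotvC y x).
set a := dotv x x; set b := dotv x y; set c := dotv y y => h.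
rewrite -subr_ge0 -(pmulr_rge0 _ yp) -/c; lra.
Qed.

Lemma sqfrob_mulmx n (M : 'M[R]_n) (x : 'cV[R]_n) :
  dotv (M *m x) (M *m x) <= sqfrob M * dotv x x.
Proof.
rewrite dotvE /sqfrob mulr_suml; apply: ler_sum => i _.
have -> : (M *m x) i 0 = dotv (row i M)^T x.
  by rewrite dotvE mxE; apply: eq_bigr => j _; rewrite !mxE.
rewrite -expr2; apply: le_trans (dotv_cauchy_schwarz _ _) _.
rewrite le_eqVlt; apply/orP; left; apply/eqP; congr (_ * _).
by rewrite dotvE; apply: eq_bigr => j _; rewrite !mxE expr2.
Qed.

(** A supremum over an unbounded set would carry no information, so the point
    is that the Frobenius norm is an upper bound. *)
Lemma opnorm_ub n (M : 'M[R]_n) (x : 'cV[R]_n) :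
  dotv x x <= 1 -> fnorm (M *m x) <= opnorm M.
Proof.
move=> x1; rewrite /opnorm.
have ub : has_ubound [set fnorm (M *m x) | x in [set x : 'cV[R]_n | fnorm x <= 1]].
  exists (fnorm M) => _ [y /= y1 <-].
  rewrite -(@ler_pXn2r _ 2)// ?nnegrE ?sqrtr_ge0// !sqr_fnorm.
  rewrite (sqfrob_cV (M *m y)); apply: le_trans (sqfrob_mulmx _ _) _.
  rewrite ler_piMr ?sqfrob_ge0// -sqfrob_cV -sqr_fnorm.
  by rewrite expr_le1// sqrtr_ge0.
apply: ub_le_sup => //; exists x => //=.
by rewrite -(@ler_pXn2r _ 2)// ?nnegrE ?sqrtr_ge0// sqr_fnorm sqfrob_cV expr1n.
Qed.

Lemma opnorm_ge0 n (M : 'M[R]_n) : 0 <= opnorm M.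
Proof.
apply: le_trans (opnorm_ub M (x := 0) _); first exact: sqrtr_ge0.
by rewrite /dotv mulmx0 mxE.
Qed.

Lemma dotv_mulmx_opnorm n (M : 'M[R]_n) (x : 'cV[R]_n) :
  dotv (M *m x) (M *m x) <= opnorm M ^+ 2 * dotv x x.
Proof.
have [x0|x0] := eqVneq (dotv x x) 0.
  by rewrite (dotv_eq0 x0) /dotv !mulmx0 mxE mulr0.
have xp : 0 < dotv x x by rewrite lt_neqAle eq_sym x0 dotv_ge0.
pose k := (Num.sqrt (dotv x x))^-1.
have k2 : k ^+ 2 * dotv x x = 1.
  by rewrite exprVn sqr_sqrtr ?dotv_ge0// mulVf.
have := @opnorm_ub _ M (k *: x).
rewrite dotvZr dotvC dotvZr mulrA -expr2 k2 => /(_ (lexx _)).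
rewrite -(@ler_pXn2r _ 2)// ?nnegrE ?sqrtr_ge0 ?opnorm_ge0// sqr_fnorm sqfrob_cV.
rewrite -scalemxAr dotvZr dotvC dotvZr mulrA -expr2 => h.
rewrite -[leLHS]mul1r -k2 mulrAC ler_wpM2r// ?dotv_ge0//.
Qed.

Lemma qform_opnorm n (M : 'M[R]_n) (x : 'cV[R]_n) :
  qform M x <= opnorm M * dotv x x.
Proof.
have := dotv_cauchy_schwarz x (M *m x); rewrite -/(qform M x) => h.
have h1 : qform M x ^+ 2 <= (opnorm M * dotv x x) ^+ 2.
  apply: le_trans h _.
  have := ler_wpM2l (dotv_ge0 x) (dotv_mulmx_opnorm M x); lra.
have b0 : 0 <= opnorm M * dotv x x by rewrite mulr_ge0 ?opnorm_ge0 ?dotv_ge0.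
apply: le_trans (ler_norm _) _.
by rewrite -(@ler_pXn2r _ 2)// ?nnegrE// real_normK ?num_real.
Qed.

Section SquareRoot.
Variables (n : nat) (Sigma S : 'M[R]_n).
Hypotheses (symS : S^T = S) (SS : S *m S = Sigma).

Lemma dotv_sqrtmx x : dotv (S *m x) (S *m x) <= opnorm Sigma * dotv x x.
Proof.
by rewrite dotv_mulmxr symS mulmxA SS dotvC qform_opnorm.
Qed.

Lemma sqfrob_sqrtmx (B : 'M[R]_n) : sqfrob (S *m B) <= opnorm Sigma * sqfrob B.
Proof.
rewrite !sqfrob_col mulr_sumr; apply: ler_sum => j _.
have -> : col j (S *m B) = S *m col j B by rewrite !colE mulmxA.
exact: dotv_sqrtmx.
Qed.

Lemma sqfrob_conj (D : 'M[R]_n) : D^T = D ->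
  sqfrob (S *m D *m S) <= opnorm Sigma ^+ 2 * sqfrob D.
Proof.
move=> symD; rewrite -mulmxA; apply: le_trans (sqfrob_sqrtmx _) _.
rewrite expr2 -mulrA ler_wpM2l ?opnorm_ge0// -(sqfrob_tr (D *m S)) trmx_mul symD symS.
exact: sqfrob_sqrtmx.
Qed.

Lemma qform_conj (D : 'M[R]_n) x : qform (S *m D *m S) x = qform D (S *m x).
Proof. by rewrite /qform -!mulmxA dotv_mulmxr symS. Qed.

End SquareRoot.

Lemma qform_diag_part n (M : 'M[R]_n) x :
  qform (diag_part M) x = \sum_i M i i * x i 0 ^+ 2.
Proof.
rewrite /qform dotvE; apply: eq_bigr => i _.
by rewrite mul_diag_mx !mxE; ring.
Qed.

Lemma sqfrob_diag_part n (M : 'M[R]_n) : sqfrob (diag_part M) = \sum_i M i i ^+ 2.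
Proof.
apply: eq_bigr => i _; rewrite (bigD1 i)//= !mxE eqxx mulr1n big1 ?addr0// => j ji.
by rewrite !mxE eq_sym (negbTE ji) mulr0n expr0n.
Qed.

Lemma mxinner_sample n (D S : 'M[R]_n) z : D^T = D -> S^T = S ->
  mxinner D ((S *m z) *m (S *m z)^T - S *m S)
  = qform (S *m D *m S) z - \tr (S *m D *m S).
Proof.
move=> symD symS; rewrite /mxinner symD mulmxBr linearB/=; congr (_ - _).
  rewrite mulmxA mxtrace_mulC [_^T *m _]mx11_scalar mxtrace_scalar mulr1n.
  by rewrite qform_conj.
by rewrite mulmxA mxtrace_mulC mulmxA.
Qed.

End MatrixNorms.

(** * The diagonal of a Kronecker sum *)

Section KroneckerDiagonal.
Variable R : realType.

Lemma kprod_ext L (d : 'I_L -> nat) (A A' : forall k, 'M[R]_(d k)) :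
  (forall k, A k = A' k) -> kprod A = kprod A'.
Proof.
elim: L d A A' => [//|L IH] d A A' AA' /=; rewrite AA'; congr tensmx.
by apply: IH => k.
Qed.

Lemma kprod1 L (d : 'I_L -> nat) i : kprod (fun k : 'I_L => 1%:M : 'M[R]_(d k)) i i = 1.
Proof.
elim: L d i => [|L IH] d i /=; first by rewrite mxE eqxx.
by rewrite mxE IH mxE eqxx mulr1.
Qed.

Lemma ksum_diagS L (d : 'I_L.+1 -> nat) (B : forall k, 'M[R]_(d k)) i :
  ksum B i i = B ord0 (mxtens_unindex i).1 (mxtens_unindex i).1
    + ksum (fun k => B (lift ord0 k)) (mxtens_unindex i).2 (mxtens_unindex i).2.
Proof.
rewrite /ksum big_ord_recl mxE; congr (_ + _).
  rewrite /= mxE/=.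
  by rewrite (kprod_ext (A' := fun k => 1%:M)) ?kprod1 ?mulr1.
rewrite !summxE; apply: eq_bigr => k _.
by rewrite /= mxE /= mxE eqxx mul1r.
Qed.

Lemma sum_mxtens m n (F : 'I_m -> 'I_n -> R) :
  \sum_(i < m * n) F (mxtens_unindex i).1 (mxtens_unindex i).2
  = \sum_i \sum_j F i j.
Proof.
rewrite pair_bigA/= (reindex (@mxtens_index m n)); last first.
  by exists (@mxtens_unindex m n) => ? _; [exact: mxtens_indexK|exact: mxtens_unindexK].
apply: eq_bigr => ij _.
by have /= := @mxtens_indexK m n ij; case: ij => i j /= [-> ->].
Qed.

Lemma le_sum_sqr (I : finType) (F : I -> R) i : F i ^+ 2 <= \sum_j F j ^+ 2.
Proof.
by rewrite (bigD1 i)//= lerDl; apply: sumr_ge0 => j _; exact: sqr_ge0.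
Qed.

Lemma kdim_gt0 L (d : 'I_L -> nat) : (forall k, (0 < d k)%N) -> (0 < kdim d)%N.
Proof. by move=> d0; rewrite kdimE prodn_gt0. Qed.

(** The diagonal of a Kronecker sum is a function f (i_1, ..., i_L) =
    c + sum_k b_k (i_k) with c = 0, and such an additive function cannot concentrate at a
    point: it lies in a space of dimension at most 1 + sum_k d_k that is
    invariant under a transitive group, which gives this constant.  For the
    induction, center b_1 by moving its mean into the rest; then
    sum f^2 = q sum b_1^2 + d_1 sum G^2 without cross term, and a weighted
    Cauchy-Schwarz inequality on f (i) = b_1 (i_1) + G (i') combines the two
    bounds.  The free constant c absorbs the means. *)
Lemma ksum_diag_le L (d : 'I_L -> nat) (B : forall k, 'M[R]_(d k)) c i :
  (forall k, (0 < d k)%N) ->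
  (c + ksum B i i) ^+ 2 * (kdim d)%:R
  <= (1 + \sum_k (d k)%:R) * \sum_j (c + ksum B j j) ^+ 2.
Proof.
elim: L d B c i => [|L IH] d B c i d0.
  have E j : ksum B j j = 0 by rewrite /ksum big_ord0 mxE.
  rewrite big_ord0 addr0 mul1r.
  by rewrite (eq_bigr _ (fun j _ => congr1 (fun t => (c + t) ^+ 2) (E j)))
    sumr_const card_ord E mulr1.
pose d' k := d (lift ord0 k); pose B' k : 'M[R]_(d' k) := B (lift ord0 k).
have d0' k : (0 < d' k)%N by exact: d0.
set q : R := (kdim d')%:R; set a : R := (d ord0)%:R; set s : R := 1 + \sum_k (d' k)%:R.
have q0 : 0 < q by rewrite ltr0n kdim_gt0.
have a0 : 0 < a by rewrite ltr0n.
have s0 : 0 < s.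
  by rewrite ltr_pwDl// sumr_ge0.
pose b0 := (\sum_j B ord0 j j) / a.
pose b j := B ord0 j j - b0.
pose G j := (c + b0) + ksum B' j j.
have fE j : c + ksum B j j = b (mxtens_unindex j).1 + G (mxtens_unindex j).2.
  by rewrite ksum_diagS /b /G; ring.
have sb : \sum_j b j = 0.
  rewrite sumrB sumr_const card_ord /b0 -mulr_natr -/a; field; rewrite gt_eqF//.
have SE : \sum_j (c + ksum B j j) ^+ 2 = q * (\sum_j b j ^+ 2) + a * (\sum_j G j ^+ 2).
  rewrite (eq_bigr _ (fun j _ => congr1 (fun t => t ^+ 2) (fE j))).
  rewrite (sum_mxtens (fun i j => (b i + G j) ^+ 2)).
  transitivity (\sum_i (q * b i ^+ 2 + 2 * b i * (\sum_j G j) + \sum_j G j ^+ 2)).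
    apply: eq_bigr => k _; rewrite (mulr_natl _ (kdim d')).
    rewrite -[in X in X + _ + _](card_ord (kdim d')) -sumr_const mulr_sumr -!big_split/=.
    by apply: eq_bigr => j _; ring.
  rewrite !big_split/= -mulr_sumr -mulr_suml -mulr_sumr sb mulr0 mul0r addr0.
  by rewrite sumr_const card_ord /a (mulr_natl _ (d ord0)).
rewrite SE fE /= natrM -/q -/a big_ord_recl -/a.
set x := b _; set y := G _.
have hx : x ^+ 2 <= \sum_j b j ^+ 2 by exact: le_sum_sqr.
have hy : y ^+ 2 * q <= s * \sum_j G j ^+ 2 by exact: IH.
move: hx hy; set Sb := \sum_j _; set SG := \sum_j _ => hx hy.
(* Weighted Cauchy-Schwarz: (a + s) (s x^2 + a y^2) - a s (x + y)^2 is the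
   square of s x - a y. *)
have -> : 1 + (a + \sum_k (d (lift ord0 k))%:R) = a + s by rewrite /s /d'; ring.
have q00 := ltW q0; have a00 := ltW a0; have s00 := ltW s0.
have h1 : x ^+ 2 * (q * (a + s)) <= Sb * (q * (a + s)).
  by apply: ler_wpM2r => //; rewrite mulr_ge0// addr_ge0.
have h2 : (a * (a + s) / s) * (y ^+ 2 * q) <= (a * (a + s) / s) * (s * SG).
  by apply: ler_wpM2l => //; rewrite divr_ge0// mulr_ge0// addr_ge0.
have h3 : 0 <= q / s * (s * x - a * y) ^+ 2.
  by rewrite mulr_ge0 ?sqr_ge0 ?divr_ge0.
have sn : s != 0 by rewrite gt_eqF.
have e2 : (a * (a + s) / s) * (s * SG) = a * (a + s) * SG by field.
have e3 : q / s * (s * x - a * y) ^+ 2 + (x + y) ^+ 2 * (a * q)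
    = x ^+ 2 * (q * (a + s)) + (a * (a + s) / s) * (y ^+ 2 * q) by field.
rewrite e2 in h2; lra.
Qed.

Lemma dmax_attained L (d : 'I_L -> nat) : (0 < L)%N -> exists k, d k = dmax d.
Proof.
move=> L0; have [|k kE] := @bigop.eq_bigmax 'I_L d; first by rewrite card_ord.
by exists k; rewrite /dmax kE.
Qed.

Lemma mmin_gt0 L (d : 'I_L -> nat) : (forall k, (0 < d k)%N) -> (0 < mmin d)%N.
Proof.
move=> d0; rewrite /mmin; elim/big_ind: _ => [|x y x0 y0|k _].
- exact: kdim_gt0.
- by rewrite leq_min x0 y0.
- rewrite /codim divn_gt0// dvdn_leq ?kdim_gt0// kdimE (bigD1 k)//=.
  exact: dvdn_mulr.
Qed.

Lemma mmin_dmax_le L (d : 'I_L -> nat) : (0 < L)%N ->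
  (mmin d * dmax d <= kdim d)%N.
Proof.
move=> L0; have [k <-] := dmax_attained d L0.
apply: leq_trans (leq_trunc_div (kdim d) (d k)); rewrite leq_mul2r; apply/orP; right.
rewrite /mmin; elim: (index_enum _) (mem_index_enum k) => // j r IH.
rewrite big_cons in_cons => /predU1P[<-|/IH h]; first exact: geq_minl.
exact: leq_trans (geq_minr _ _) h.
Qed.

(** Here (1 + sum_k d_k) / p <= 4 L d_max / p and d_max / p <= 1 / m_min. *)
Lemma Kset_diag_le L (d : 'I_L -> nat) (Delta : 'M[R]_(kdim d)) i :
  (0 < L)%N -> (forall k, (0 < d k)%N) -> Kset R d Delta ->
  Delta i i ^+ 2 <= 4 * (L%:R / (mmin d)%:R) * \sum_j Delta j j ^+ 2.
Proof.
move=> L0 d0 [B _ <-].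
have := ksum_diag_le B 0 i d0; rewrite add0r.
rewrite (eq_bigr (fun j => ksum B j j ^+ 2)); last by move=> j _; rewrite add0r.
set x := _ ^+ 2; set S := \sum_j _ ^+ 2.
have S0 : 0 <= S by apply: sumr_ge0 => j _; exact: sqr_ge0.
have m0 : 0 < (mmin d)%:R :> R by rewrite ltr0n mmin_gt0.
have p0 : 0 < (kdim d)%:R :> R by rewrite ltr0n kdim_gt0.
have mp : (mmin d)%:R * (dmax d)%:R <= (kdim d)%:R :> R.
  by rewrite -natrM ler_nat mmin_dmax_le.
have D1 : 1 <= (dmax d)%:R :> R.
  by have [k <-] := dmax_attained d L0; rewrite ler1n d0.
have L1 : 1 <= L%:R :> R by rewrite ler1n.
have sd : 1 + \sum_k (d k)%:R <= 4 * (L%:R * (dmax d)%:R) :> R.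
  have : \sum_k (d k)%:R <= L%:R * (dmax d)%:R :> R.
    apply: (@le_trans _ _ (\sum_(k < L) (dmax d)%:R)).
      by apply: ler_sum => k _; rewrite ler_nat; exact: bigop.leq_bigmax.
    by rewrite sumr_const card_ord mulr_natl.
  have : 1 <= L%:R * (dmax d)%:R :> R by exact: mulr_ege1.
  lra.
move=> h.
have h1 : x * (kdim d)%:R <= 4 * (L%:R * (dmax d)%:R) * S.
  by apply: le_trans h _; rewrite ler_wpM2r.
rewrite -(ler_pM2r p0); apply: le_trans h1 _.
have -> : 4 * (L%:R / (mmin d)%:R) * S * (kdim d)%:R
  = 4 * L%:R * S / (mmin d)%:R * (kdim d)%:R :> R by field; rewrite gt_eqF.
apply: (@le_trans _ _ (4 * L%:R * S / (mmin d)%:R * ((mmin d)%:R * (dmax d)%:R))).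
  rewrite le_eqVlt; apply/orP; left; apply/eqP; field; rewrite gt_eqF//.
by apply: ler_wpM2l => //; rewrite divr_ge0 ?ler0n// mulr_ge0// mulr_ge0// ler0n.
Qed.

End KroneckerDiagonal.

(** * The concentration bound *)

(** The optimization in Chernoff's method.  Below, r bounds the Frobenius norm
    and 2 sqrt (L / m) r the operator norm of the form.  The choice
    l = eta sqrt d / (r (1 + sqrt (d L / m))) balances the Gaussian and the
    exponential regime of the tail; it works because
    sqrt L (1 + sqrt (d / m)) >= 1 + sqrt (d L / m). *)
Lemma chernoff_parameter (R : rcfType) (h K d L m r : R) :
  0 < h -> 0 <= K -> 1 <= d -> 1 <= L -> 0 < m -> 0 < r ->
  let eta := (2 * h)^-1 in
  let C := (1 + K * eta ^+ 2) / eta in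
  exists l : R, [/\ 0 < l, h * (l * (2 * Num.sqrt (L / m) * r)) <= 1 &
   forall F, F <= r ^+ 2 -> K * (l ^+ 2 * F)
     - l * (r * (C * Num.sqrt (d * L) * (1 + Num.sqrt (d / m)))) <= - d].
Proof.
move=> h0 K0 d1 L1 m0 r0 eta C.
have eta0 : 0 < eta by rewrite invr_gt0 mulr_gt0.
have d0 : 0 <= d by lra.
have L0 : 0 <= L by lra.
set s := Num.sqrt d; set k := Num.sqrt L; set q := Num.sqrt m.
have q0 : 0 < q by rewrite sqrtr_gt0.
have s0 : 0 < s by rewrite sqrtr_gt0; lra.
have k1 : 1 <= k by rewrite -sqrtr1 ler_sqrt.
have s2 : s ^+ 2 = d by rewrite sqr_sqrtr.
have -> : Num.sqrt (L / m) = k / q by rewrite sqrtrM// sqrtrV// ltW.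
have -> : Num.sqrt (d / m) = s / q by rewrite sqrtrM// sqrtrV// ltW.
have -> : Num.sqrt (d * L) = s * k by rewrite sqrtrM.
set v := s / q.
have v0 : 0 <= v by rewrite divr_ge0// ltW.
pose y := 1 + v * k.
have y1 : 1 <= y by rewrite /y; have : 0 <= v * k by [rewrite mulr_ge0//; lra]; lra.
have y0 : 0 < y by lra.
have hn : h != 0 by rewrite gt_eqF.
have rn : r != 0 by rewrite gt_eqF.
have qn : q != 0 by rewrite gt_eqF.
have yn : y != 0 by rewrite gt_eqF.
have en : eta != 0 by rewrite gt_eqF.
exists (eta * s / (r * y)); split.
- by rewrite divr_gt0 ?mulr_gt0.
- have -> : h * (eta * s / (r * y) * (2 * (k / q) * r)) = (y - 1) / y.
    have -> : y - 1 = s / q * k by rewrite /y /v; ring.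
    by rewrite /eta; field; rewrite rn qn hn yn.
  by rewrite ler_pdivrMr// mul1r; lra.
- move=> F Fr.
  have -> : eta * s / (r * y) * (r * (C * (s * k) * (1 + v)))
      = (1 + K * eta ^+ 2) * s ^+ 2 * (k * (1 + v) / y).
    by rewrite /C; field; rewrite rn yn en.
  have h1 : 1 <= k * (1 + v) / y.
    by rewrite ler_pdivlMr// mul1r /y; lra.
  have h2 : (eta * s / (r * y)) ^+ 2 * F <= (eta * s) ^+ 2.
    have -> : (eta * s / (r * y)) ^+ 2 = (eta * s) ^+ 2 / y ^+ 2 / r ^+ 2.
      by field; rewrite rn yn.
    apply: (@le_trans _ _ ((eta * s) ^+ 2 / y ^+ 2 / r ^+ 2 * r ^+ 2)).
      by rewrite ler_wpM2l// !divr_ge0 ?sqr_ge0.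
    rewrite divfK ?expf_neq0// ler_pdivrMr ?exprn_gt0// ler_peMr ?sqr_ge0//.
    by rewrite exprn_ege1.
  have h3 : K * ((eta * s / (r * y)) ^+ 2 * F) <= K * (eta * s) ^+ 2 by rewrite ler_wpM2l.
  have h4 : (1 + K * eta ^+ 2) * s ^+ 2 <=
     (1 + K * eta ^+ 2) * s ^+ 2 * (k * (1 + v) / y).
    by rewrite ler_peMr// mulr_ge0 ?sqr_ge0// addr_ge0// mulr_ge0 ?sqr_ge0.
  move: h3 h4; set w := (k * _ / y); set e := (_ * F); rewrite exprMn s2; lra.
Qed.

Lemma measurable_sublevel (disp : measure_display) (T : measurableType disp)
    (R : realType) (t : R) (W : T -> R) : measurable_fun setT W ->
  measurable [set w | W w <= t].
Proof.
move=> mW; have := mW measurableT _ (measurable_itv `]-oo, t]).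
by rewrite setTI (_ : _ @^-1` _ = [set w | W w <= t])//.
Qed.

Lemma probability_complement_le (disp : measure_display) (T : measurableType disp)
    (R : realType) (P : probability T R) (E B : set T) (b : R) :
  measurable E -> measurable B -> setT `<=` E `|` B -> (P B <= b%:E)%E ->
  ((1 - b)%:E <= P E)%E.
Proof.
move=> mE mB EB Bb.
rewrite EFinB leeBlDr//; apply: (@le_trans _ _ (P E + P B)%E); last exact: leeD2l.
apply: le_trans (measureU2 _ mE mB); rewrite -(probability_setT P).
by rewrite le_measure ?inE//; exact: measurableU.
Qed.

Lemma qform_diag_part_le (R : realType) n (M : 'M[R]_n) (delta : R) x :
  (forall i, `|M i i| <= delta) ->
  `|qform (diag_part M) x| <= delta * dotv x x.
Proof.
move=> Md; rewrite qform_diag_part; apply: le_trans (ler_norm_sum _ _ _) _.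
rewrite dotvE mulr_sumr; apply: ler_sum => i _.
by rewrite normrM -expr2 (ger0_norm (sqr_ge0 _)) ler_wpM2r ?sqr_ge0.
Qed.

Lemma Kset_diag_norm_le (R : realType) (L : nat) (d : 'I_L -> nat)
    (Delta : 'M[R]_(kdim d)) i :
  (0 < L)%N -> (forall k, (0 < d k)%N) -> Kset R d Delta ->
  `|Delta i i| <= 2 * Num.sqrt (L%:R / (mmin d)%:R) * fnorm (diag_part Delta).
Proof.
move=> L0 d0 KD; have := Kset_diag_le i L0 d0 KD.
rewrite -sqfrob_diag_part -sqr_fnorm => h.
have f0 : 0 <= fnorm (diag_part Delta) by exact: sqrtr_ge0.
rewrite -(@ler_pXn2r _ 2)// ?nnegrE ?mulr_ge0 ?sqrtr_ge0//.
rewrite real_normK ?num_real// !exprMn sqr_sqrtr ?divr_ge0//.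
by have -> : (2 : R) ^+ 2 = 4 by ring.
Qed.

Theorem lemma2p2 (R : realType) (C0 : R) :
  exists Cdiag c : R, [/\ 0 < Cdiag, 0 < c &
    forall (L : nat) (d : 'I_L -> nat),
      (2 <= L)%N -> (forall k, (0 < d k)%N) ->
    forall (Psi : forall k, 'M[R]_(d k))
      (Omega0 Sigma0 Sigma0_half : 'M[R]_(kdim d)),
      (forall k, symmx (Psi k)) ->
      Omega0 = ksum Psi -> posdef Omega0 ->
      Sigma0 = invmx Omega0 -> is_sqrtmx Sigma0 Sigma0_half ->
    forall (disp : measure_display) (T : measurableType disp)
      (P : probability T R) (Z : 'I_(kdim d) -> {RV P >-> R})
      (X : T -> tensor R d) (Shat : T -> 'M[R]_(kdim d)),
      mutually_independent Z ->
      (forall j, 'E_P[Z j] = 0)%E ->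
      (forall j, 'E_P[(fun w => Z j w ^+ 2)%R] = 1)%E ->
      (forall j, (psi2norm P (Z j) <= C0%:E)%E) ->
      (forall w, vecT (X w) = Sigma0_half *m \col_j Z j w) ->
      (forall w, Shat w = vecT (X w) *m (vecT (X w))^T) ->
    forall Delta : 'M[R]_(kdim d),
      Kset R d Delta -> diag_part Delta != 0 ->
      ((1 - \sum_(k < L) 2 * expR (- (c * (d k)%:R)))%R%:E <=
        P [set w | (
          `|mxinner (diag_part Delta) (Shat w - Sigma0)|
            / (opnorm Sigma0 * fnorm (diag_part Delta))
          <= Cdiag * Num.sqrt ((dmax d)%:R * L%:R)
             * (1 + Num.sqrt ((dmax d)%:R / (mmin d)%:R)))%R])%E].
Proof.
pose g := (`|C0| + 1) ^+ 2.
have g1 : 1 <= g by rewrite /g exprn_ege1// lerDr.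
have g0 : 0 < g by exact: lt_le_trans ltr01 g1.
pose K := 2048 * expR 1 * g ^+ 2.
have K0 : 0 <= K.
  apply: mulr_ge0; last exact: sqr_ge0.
  by apply: mulr_ge0; [exact: ler0n|exact: expR_ge0].
pose h := 128 * g.
have h0 : 0 < h by apply: mulr_gt0 => //; rewrite ltr0n.
pose eta := (2 * h)^-1.
have eta0 : 0 < eta by rewrite invr_gt0; apply: mulr_gt0.
pose C := (1 + K * eta ^+ 2) / eta.
have C_gt0 : 0 < C.
  by rewrite divr_gt0// ltr_pwDl// mulr_ge0// sqr_ge0.
exists C, 1; split => // L d L2 d0 Psi Omega0 Sigma0 S _ _ _ _ [[symS _] SS].
move=> disp T P Z X Shat indZ EZ EZ2 Zpsi XE ShE Delta KD _.
have L0 : (0 < L)%N by exact: leq_trans L2.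
have Z0 i : (\int[P]_w (Z i w)%:E = 0)%E by have := EZ i; rewrite unlock.
have Z1 i : (\int[P]_w (Z i w ^+ 2)%:E = 1)%E by have := EZ2 i; rewrite unlock.
have Zg i : (\int[P]_w (expR (Z i w ^+ 2 / g))%:E <= 2%:E)%E.
  exact: psi2norm_leW.
set D := diag_part Delta.
have symD : D^T = D by rewrite /D /diag_part tr_diag_mx.
pose A := S *m D *m S.
have symA : A^T = A by rewrite /A !trmx_mul symD symS mulmxA.
have WE w : mxinner D (Shat w - Sigma0) = centered_form Z A w.
  by rewrite ShE XE -SS mxinner_sample.
set r := opnorm Sigma0 * fnorm D.
set bnd := C * _ * _.
have bnd0 : 0 <= bnd.
  apply: mulr_ge0; last by rewrite addr_ge0// sqrtr_ge0.
  by apply: mulr_ge0; [exact: ltW|exact: sqrtr_ge0].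
(* A vanishing denominator makes the quotient 0. *)
have [r0|r0] := eqVneq r 0.
  rewrite [X in P X](_ : _ = setT); last first.
    by apply/seteqP; split=> // w _ /=; rewrite r0 invr0 mulr0.
  have tails0 : 0 <= \sum_(k < L) 2 * expR (- (1 * (d k)%:R)) :> R.
    by apply: sumr_ge0 => k _; apply: mulr_ge0 => //; exact: expR_ge0.
  by rewrite probability_setT lee_fin; lra.
have fD0 : 0 <= fnorm D by exact: sqrtr_ge0.
have rp : 0 < r by rewrite lt_neqAle eq_sym r0 mulr_ge0 ?opnorm_ge0.
have m0 : 0 < (mmin d)%:R :> R by rewrite ltr0n mmin_gt0.
have L1 : 1 <= L%:R :> R by rewrite ler1n.
have [kmax kE] := dmax_attained d L0.
have D1 : 1 <= (dmax d)%:R :> R by rewrite -kE ler1n.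
have [l [l0 lo lt]] := chernoff_parameter h0 K0 D1 L1 m0 rp.
set o := 2 * _ * r in lo.
have Ao x : `|qform A x| <= o * dotv x x.
  rewrite (qform_conj symS).
  apply: le_trans (qform_diag_part_le _ (fun i => Kset_diag_norm_le i L0 d0 KD)) _.
  have -> : o = 2 * Num.sqrt (L%:R / (mmin d)%:R) * fnorm D * opnorm Sigma0.
    by rewrite /o /r; ring.
  rewrite -[leRHS]mulrA; apply: ler_wpM2l; last exact: dotv_sqrtmx.
  by rewrite !mulr_ge0// sqrtr_ge0.
have Fr : sqfrob A <= r ^+ 2.
  by rewrite exprMn sqr_fnorm; exact: sqfrob_conj.
have mW := measurable_centered_form Z A.
have mWn : measurable_fun setT (fun w => `|centered_form Z A w|).
  exact: measurableT_comp.
pose B := [set w | r * bnd <= `|centered_form Z A w|].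
have PB : (P B <= (2 * expR (- (dmax d)%:R))%:E)%E.
  apply: le_trans (hanson_wright g1 indZ Z0 Z1 Zg symA Ao _ l0 lo) _.
  by rewrite lee_fin ler_pM2l// ler_expR; exact: lt.
have tail : 2 * expR (- (dmax d)%:R) <= \sum_(k < L) 2 * expR (- (1 * (d k)%:R)) :> R.
  rewrite (bigD1 kmax)//= mul1r kE lerDl; apply: sumr_ge0 => k _.
  by apply: mulr_ge0 => //; exact: expR_ge0.
apply: (probability_complement_le (B := B)).
- under eq_set do rewrite WE.
  by apply: measurable_sublevel; exact: measurable_funM.
- exact: measurable_superlevel.
- move=> w _; rewrite /B /= WE ler_pdivrMr// (mulrC r).
  by case: (leP `|centered_form Z A w| (bnd * r)) => [|/ltW]; [left|right].
- by rewrite (le_trans PB)// lee_fin.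
Qed.
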